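(* Let $\pi:P\to Q$ be a linear surjection of polytopes such that (i) $P$ has exactly $\dim(P)+2$ vertices, and (ii) the point configuration $\mathcal{A}$ consisting of the images under $\pi$ of the vertices of $P$ has only coherent (regular) subdivisions. Then the proper part of the Baues poset $\omega(P\xrightarrow{\pi}Q)$, i.e. the poset of all proper $\pi$-induced subdivisions of $Q$, has the homotopy type of a sphere of dimension $\dim(P)-\dim(Q)-1$.
   Context: For a linear map $\pi$ with $\pi(P)=Q$: a polytopal subdivision of $Q$ is $\pi$-induced if it equals $\{\pi(F):F\in\mathcal{F}\}$ for a collection $\mathcal{F}$ of faces of $P$ such that $\pi(F)\subseteq\pi(F')$ implies $F=F'\cap\pi^{-1}(\pi(F))$; it is labelled by $\mathcal{F}$. The Baues poset $\omega(P\xrightarrow{\pi}Q)$ is the set of $\pi$-induced subdivisions ordered by $\mathcal{F}_1\le\mathcal{F}_2$ iff $\bigcup\mathcal{F}_1\subseteq\bigcup\mathcal{F}_2$; its proper part is obtained by removing its unique maximal element (the trivial subdivision $\{P\}$). A subdivision of a point configuration $\mathcal{A}=(a_1,\dots,a_n)$ in $\mathbb{R}^d$ is a polytopal subdivision of $\mathrm{conv}(\mathcal{A})$ whose cells are convex hulls of subsets of $\mathcal{A}$; it is coherent (regular) if there are heights $w_1,\dots,w_n$ such that its cells are exactly the projections of the lower faces of $\mathrm{conv}\{(a_i,w_i)\}\subseteq\mathbb{R}^{d+1}$. The homotopy type of a poset means that of the geometric realization of its order complex (the simplicial complex of its chains). *)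

(* Defs.v *)
From HB Require Import structures.
From mathcomp Require Import all_boot all_order all_algebra.
From mathcomp Require Import boolp classical_sets functions cardinality reals topology normedtype.

Set Implicit Arguments.
Unset Strict Implicit.
Unset Printing Implicit Defensive.

Import Order.TTheory GRing.Theory Num.Theory.
Import numFieldNormedType.Exports.
Local Open Scope classical_set_scope.
Local Open Scope ring_scope.

Section Geometry.
Variable R : realType.

Definition dotv (d : nat) (c x : 'rV[R]_d) : R := \sum_(i < d) c 0 i * x 0 i.

Definition convf (d k : nat) (a : 'I_k -> 'rV[R]_d) (I : pred 'I_k) : set 'rV[R]_d :=
  [set x | exists lam : 'I_k -> R,
     (forall i, 0 <= lam i) /\ (forall i, ~~ I i -> lam i = 0) /\
     \sum_(i < k) lam i = 1 /\ x = \sum_(i < k) lam i *: a i].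

Definition conv (d : nat) (s : seq 'rV[R]_d) : set 'rV[R]_d :=
  convf (fun i : 'I_(size s) => s`_i) predT.

Definition polytope (d : nat) (C : set 'rV[R]_d) : Prop :=
  (exists s : seq 'rV[R]_d, C = conv s) /\ C !=set0.

(* F is a face of C: the set of minimizers over C of some linear functional
   (c = 0 gives C itself). *)
Definition face (d : nat) (C F : set 'rV[R]_d) : Prop :=
  exists c : 'rV[R]_d,
    F = [set x | C x /\ forall y, C y -> dotv c x <= dotv c y].

Definition vertices (d : nat) (C : set 'rV[R]_d) : set 'rV[R]_d :=
  [set v | face C [set v]].

Definition aff_indep_pts (d k : nat) (p : 'I_k.+1 -> 'rV[R]_d) : Prop :=
  \rank (\matrix_(i < k) (p (lift ord0 i) - p ord0)) = k.

Definition has_aff_pts (d : nat) (S : set 'rV[R]_d) (k : nat) : Prop :=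
  exists p : 'I_k.+1 -> 'rV[R]_d, (forall i, S (p i)) /\ aff_indep_pts p.

Definition is_affdim (d : nat) (S : set 'rV[R]_d) (k : nat) : Prop :=
  has_aff_pts S k /\ ~ has_aff_pts S k.+1.

Definition polysubdiv (d : nat) (Q : set 'rV[R]_d) (S : set (set 'rV[R]_d)) : Prop :=
  [/\ finite_set S,
      (forall C, S C -> polytope C),
      (forall C F, S C -> face C F -> S F),
      (forall C D, S C -> S D ->
         C `&` D = set0 \/ (face C (C `&` D) /\ face D (C `&` D))) &
      \bigcup_(C in S) C = Q].

Definition pi_induced (n m : nat) (pi : 'rV[R]_n -> 'rV[R]_m)
    (P : set 'rV[R]_n) (Fs : set (set 'rV[R]_n)) : Prop :=
  [/\ (forall F, Fs F -> face P F),
      polysubdiv (pi @` P) [set pi @` F | F in Fs] &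
      (forall F F', Fs F -> Fs F' -> pi @` F `<=` pi @` F' ->
         F = F' `&` (pi @^-1` (pi @` F)))].

Definition baues (n m : nat) (pi : 'rV[R]_n -> 'rV[R]_m) (P : set 'rV[R]_n) :
  set (set (set 'rV[R]_n)) := [set Fs | pi_induced pi P Fs].

Definition baues_le (n : nat) (Fs1 Fs2 : set (set 'rV[R]_n)) : Prop :=
  \bigcup_(F in Fs1) F `<=` \bigcup_(F in Fs2) F.

Definition proper_part (T : Type) (X : set T) (le : T -> T -> Prop) : set T :=
  [set x | X x /\ ~ (forall y, X y -> le y x)].

Definition config_subdiv (d k : nat) (a : 'I_k -> 'rV[R]_d) (S : set (set 'rV[R]_d)) : Prop :=
  polysubdiv (convf a predT) S /\
  (forall C, S C -> exists I : {set 'I_k}, C = convf a (mem I)).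

Definition lift_pt (d : nat) (x : 'rV[R]_d) (w : R) : 'rV[R]_(d + 1) :=
  row_mx x (w%:M : 'rV[R]_1).

Definition proj_pt (d : nat) (y : 'rV[R]_(d + 1)) : 'rV[R]_d := lsubmx y.

Definition lower_face (d : nat) (L F : set 'rV[R]_(d + 1)) : Prop :=
  exists c : 'rV[R]_d,
    F = [set x | L x /\ forall y, L y ->
           dotv (lift_pt c 1) x <= dotv (lift_pt c 1) y].

Definition coherent_subdiv (d k : nat) (a : 'I_k -> 'rV[R]_d) (S : set (set 'rV[R]_d)) : Prop :=
  exists w : 'I_k -> R,
    S = [set (@proj_pt d) @` F | F in
          [set F | lower_face (convf (fun i => lift_pt (a i) (w i)) predT) F]].

Definition only_coherent (d k : nat) (a : 'I_k -> 'rV[R]_d) : Prop :=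
  forall S, config_subdiv a S -> coherent_subdiv a S.

(* geometric realization of the order complex of (X, le), using an
   enumeration e of X as coordinates: points of the standard simplex in R^N
   whose support is a chain *)
Definition realization (T : Type) (le : T -> T -> Prop) (N : nat) (e : 'I_N -> T) :
  set 'rV[R]_N :=
  [set t | (forall i, 0 <= t 0 i) /\ \sum_(i < N) t 0 i = 1 /\
           (forall i j, 0 < t 0 i -> 0 < t 0 j -> le (e i) (e j) \/ le (e j) (e i))].

(* Euclidean unit sphere in R^N, i.e. S^(N-1) (empty for N = 0) *)
Definition usphere (N : nat) : set 'rV[R]_N :=
  [set x | \sum_(i < N) x 0 i ^+ 2 = 1].

Definition unit_int : set R := [set t | 0 <= t <= 1].

Definition homotopic (U : topologicalType) (A : set U) (h1 h2 : U -> U) : Prop :=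
  exists H : R * U -> U,
    {within unit_int `*` A, continuous H} /\
    (forall t x, unit_int t -> A x -> A (H (t, x))) /\
    (forall x, A x -> H (0, x) = h1 x /\ H (1, x) = h2 x).

Definition homotopy_equiv (U V : topologicalType) (A : set U) (B : set V) : Prop :=
  exists (f : U -> V) (g : V -> U),
    [/\ {within A, continuous f}, f @` A `<=` B,
        {within B, continuous g} & g @` B `<=` A] /\
    homotopic A (g \o f) idfun /\ homotopic B (f \o g) idfun.

Definition htype_sphere (T : Type) (X : set T) (le : T -> T -> Prop) (k : nat) : Prop :=
  exists (N : nat) (e : 'I_N -> T),
    injective e /\ range e = X /\ homotopy_equiv (realization le e) (@usphere k).

End Geometry.

(* Main.v *)
Require Import Defs.
From HB Require Import structures.
From mathcomp Require Import all_boot all_order all_algebra.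
From mathcomp Require Import boolp classical_sets functions cardinality reals topology normedtype.
From mathcomp Require Import ring lra.
From mathcomp Require Import derive realfun.

Set Implicit Arguments.
Unset Strict Implicit.
Unset Printing Implicit Defensive.

Import Order.TTheory GRing.Theory Num.Theory.
Import numFieldNormedType.Exports.
Local Open Scope classical_set_scope.
Local Open Scope ring_scope.

(* Height vectors [w] on the vertices are grouped by their pattern, the family of
   all sets of labels on which some affine function below [w] is tight; the
   patterns are the cones of the secondary fan of the projected configuration.
   As [P] has dim P + 2 vertices, these satisfy a single affine dependency, with
   Radon parts P1 and P2, and a regular subdivision is pi-induced exactly when
   its pattern contains both or neither of P1 and P2 ("balanced"). Since every
   subdivision is regular, the proper part of the Baues poset is the poset of
   balanced patterns other than the full one. Its order complex maps to the space
   of heights with such patterns, and barycentric coordinates of the fan, with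
   the unbalanced patterns dropped, give a homotopy inverse. Finally, lowering
   the heights on P1 or on P2 retracts that space onto the heights annihilated by
   the dependency; modulo affine functions on Q these form a space of dimension
   dim P - dim Q without its origin. *)

(** Images of vertices may coincide or fall inside cells, so a geometric subdivision does not
    remember its labels; patterns record which labels are tight, and coherence of the image has to
    be upgraded to the labelled level. A larger pattern is a coarser subdivision, and the full one
    belongs to the affine heights. The fan is never handled as a polyhedral complex: for each label
    set [s], [gap s w] is the excess of the heights over their lower hull, tested against the
    counting measure of [s]. It vanishes exactly when [s] is in the pattern, and it is linear on
    each closed cone. The gaps therefore determine the coordinates of [w] in the barycentric
    subdivision of the fan, and these coordinates are continuous because they are the unique
    solution of closed equations in a compact set. Lowering the Radon part on which the heights are
    in excess keeps a pattern balanced because the other part never becomes tight; the same fact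
    keeps the path away from the full pattern. *)

Lemma cvg_bigsum (K : numFieldType) (V : normedModType K) (T : Type) (I : Type)
    (r : seq I) (P : pred I) (F : set_system T) {FF : Filter F} (f : I -> T -> V) (a : I -> V) :
  (forall i, P i -> f i x @[x --> F] --> a i) ->
  \sum_(i <- r | P i) f i x @[x --> F] --> \sum_(i <- r | P i) a i.
Proof. by move=> fa; apply: cvg_big => //; exact: add_continuous. Qed.

Lemma continuous_bigsum (K : numFieldType) (V : normedModType K)
    (T : topologicalType) (I : Type) (r : seq I) (P : pred I) (f : I -> T -> V) :
  (forall i, P i -> continuous (f i)) ->
  continuous (fun x => \sum_(i <- r | P i) f i x).
Proof. by move=> fc x; apply: cvg_bigsum => i /fc; apply. Qed.

Lemma continuous_mulr (K : numFieldType) (T : topologicalType) (g : T -> K) (c : K) :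
  continuous g -> continuous (fun x => g x * c).
Proof. by move=> gc x; apply: cvgMl; apply: gc. Qed.

Lemma continuous_mulf (K : numFieldType) (T : topologicalType) (f g : T -> K) :
  continuous f -> continuous g -> continuous (fun x => f x * g x).
Proof. by move=> fc gc x; apply: cvgM; [apply: fc|apply: gc]. Qed.

Lemma continuous_compose (T U V : topologicalType) (f : T -> U) (g : U -> V) :
  continuous f -> continuous g -> continuous (g \o f).
Proof. by move=> fc gc x; apply: continuous_comp; [apply: fc|apply: gc]. Qed.

Lemma continuous_fst (T U : topologicalType) : continuous (@fst T U).
Proof. by move=> x; apply: cvg_fst. Qed.

Lemma continuous_snd (T U : topologicalType) : continuous (@snd T U).
Proof. by move=> x; apply: cvg_snd. Qed.

Lemma continuous_subr (K : numFieldType) (T : topologicalType) (f g : T -> K) :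
  continuous f -> continuous g -> continuous (fun x => f x - g x).
Proof. by move=> fc gc x; apply: cvgB; [apply: fc|apply: gc]. Qed.

Lemma continuous_normB (K : numFieldType) (T : topologicalType) (g : T -> K) (c : K) :
  continuous g -> continuous (fun x => `|c - g x|).
Proof. by move=> gc x; apply: cvg_norm; apply: cvgB; [apply: cvg_cst|apply: gc]. Qed.

Lemma continuous_modulus (K : realFieldType) (T : topologicalType) (f : T -> K)
    (E : T -> T -> K) :
  (forall x, continuous (E x)) -> (forall x, E x x = 0) ->
  (forall x y, f x <= f y + E x y) -> (forall x y, f y <= f x + E x y) ->
  continuous f.
Proof.
move=> Ec E0 fE1 fE2 x; apply: (@squeeze_cvgr _ _ _ _ (fun y => f x - E x y)
  (fun y => f x + E x y)).
- by near=> y; rewrite lerBlDr fE1 fE2.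
- by rewrite -[X in _ --> X]subr0 -(E0 x); apply: cvgB; [apply: cvg_cst|apply: Ec].
- by rewrite -[X in _ --> X]addr0 -(E0 x); apply: cvgD; [apply: cvg_cst|apply: Ec].
Unshelve. all: by end_near. Qed.

Lemma continuous_coord (K : numFieldType) (m n : nat) i j :
  continuous (fun M : 'M[K]_(m, n) => M i j).
Proof. exact: coord_continuous. Qed.

Lemma closed_comp_continuous (T U : topologicalType) (f : T -> U) (D : set U) :
  continuous f -> closed D -> closed (f @^-1` D).
Proof. by move=> cf; apply: preimage_closed => x _; apply: cf. Qed.

(** * Linear programming duality *)

Section Farkas.
Variables (R : realFieldType) (V : lmodType R).

Definition is_lin (f : V -> R) := forall a x y, f (a *: x + y) = a * f x + f y.

Lemma is_linD f x y : is_lin f -> f (x + y) = f x + f y.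
Proof. by move=> fl; rewrite -[x]scale1r fl mul1r scale1r. Qed.

Lemma is_lin0 f : is_lin f -> f 0 = 0.
Proof. by move=> fl; apply: (addrI (f 0)); rewrite -is_linD // !addr0. Qed.

Lemma is_linZ f a x : is_lin f -> f (a *: x) = a * f x.
Proof. by move=> fl; rewrite -[a *: x]addr0 fl (is_lin0 fl) addr0. Qed.

(* Bartl's induction: either the first functional is superfluous, or some x0
   violates the conclusion for the others, and one projects along x0 onto the
   kernel of the first functional. *)
Lemma farkas n (phi : 'I_n -> V -> R) (b : V -> R) :
  (forall i, is_lin (phi i)) -> is_lin b ->
  (forall x, (forall i, phi i x <= 0) -> b x <= 0) ->
  exists y : 'I_n -> R,
    (forall i, 0 <= y i) /\ forall x, b x = \sum_i y i * phi i x.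
Proof.
elim: n phi b => [|n IH] phi b philin blin Hb.
  exists (fun _ => 0); split=> // x; rewrite big_ord0.
  have b0 z : b z <= 0 by apply: Hb; case.
  apply/eqP; rewrite eq_le b0 /=.
  by have := b0 ((-1) *: x); rewrite (is_linZ _ _ blin) mulN1r oppr_le0.
have [Hsup|] := pselect (forall x, (forall i, phi (lift ord0 i) x <= 0) -> b x <= 0).
  have [|y [y0 yb]] := IH (fun i => phi (lift ord0 i)) b _ blin Hsup.
    by move=> i; apply: philin.
  exists (fun i => if unlift ord0 i is Some j then y j else 0); split.
    by move=> i; case: unliftP.
  move=> x; rewrite big_ord_recl unlift_none mul0r add0r yb.
  by apply: eq_bigr => i _; rewrite /= liftK.
move=> /existsNP[x1 /not_implyP[x1le /negP]]; rewrite -ltNge => bx1.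
have px1 : 0 < phi ord0 x1.
  rewrite ltNge; apply/negP => le0; move: bx1; rewrite ltNge => /negP; apply.
  apply: Hb => i; case: (unliftP ord0 i) => [j ->|->] //.
pose x0 := (phi ord0 x1)^-1 *: x1.
have p0x0 : phi ord0 x0 = 1 by rewrite is_linZ // mulVf // gt_eqF.
have bx0 : 0 < b x0 by rewrite is_linZ // mulr_gt0 // invr_gt0.
have pix0 i : phi (lift ord0 i) x0 <= 0.
  by rewrite is_linZ // mulr_ge0_le0 // invr_ge0 ltW.
pose proj f (x : V) : R := f x - f x0 * phi ord0 x.
have projE f x : is_lin f -> proj f x = f (x - phi ord0 x *: x0).
  by move=> fl; rewrite -scaleNr addrC fl /proj; ring.
have projl f : is_lin f -> is_lin (proj f).
  by move=> fl a x y; rewrite /proj fl (philin ord0); ring.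
have [|||y [y0 yb]] := IH (fun i => proj (phi (lift ord0 i))) (proj b).
- by move=> i; apply/projl/philin.
- exact: projl.
- move=> x Hx; rewrite projE //; apply: Hb => i.
  case: (unliftP ord0 i) => [j ->|->]; first by rewrite -projE.
  by rewrite -projE // /proj p0x0 mul1r subrr.
exists (fun i => if unlift ord0 i is Some j then y j
   else b x0 - \sum_j y j * phi (lift ord0 j) x0); split.
  move=> i; case: unliftP => // _; rewrite subr_ge0 (le_trans _ (ltW bx0)) //.
  by apply: sumr_le0 => j _; rewrite mulr_ge0_le0.
move=> x; rewrite big_ord_recl unlift_none.
have -> : \sum_(i < n) (if unlift ord0 (lift ord0 i) is Some j then y j
   else b x0 - \sum_j y j * phi (lift ord0 j) x0) * phi (lift ord0 i) x
   = \sum_(i < n) y i * phi (lift ord0 i) x.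
  by apply: eq_bigr => i _; rewrite liftK.
have := yb x; rewrite /proj => /eqP; rewrite subr_eq => /eqP ->.
under eq_bigr => i _ do rewrite mulrBr mulrA.
by rewrite sumrB -mulr_suml; ring.
Qed.

End Farkas.

Section SecondaryFan.
Variables (R : realType) (p k : nat) (G : 'M[R]_(p, k)).
(* Row vectors [l] evaluate at the columns of [G]; [e1] is the functional that
   takes the value 1 on all of them, so the columns are homogenized points. *)
Variable e1 : 'rV[R]_p.
Hypothesis e1G : forall i, (e1 *m G) 0 i = 1.

Definition ev (l : 'rV[R]_p) (i : 'I_k) : R := (l *m G) 0 i.

Lemma evD l l' i : ev (l + l') i = ev l i + ev l' i.
Proof. by rewrite /ev mulmxDl mxE. Qed.

Lemma evZ c l i : ev (c *: l) i = c * ev l i.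
Proof. by rewrite /ev -scalemxAl mxE. Qed.

Lemma evN l i : ev (- l) i = - ev l i.
Proof. by rewrite /ev mulNmx mxE. Qed.

Lemma evB l l' i : ev (l - l') i = ev l i - ev l' i.
Proof. by rewrite evD evN. Qed.

Lemma ev_e1 i : ev e1 i = 1. Proof. exact: e1G. Qed.

Definition below (l : 'rV[R]_p) (w : 'rV[R]_k) := forall i, ev l i <= w 0 i.

Definition contact (l : 'rV[R]_p) (w : 'rV[R]_k) : {set 'I_k} :=
  [set i | ev l i == w 0 i].

(** For homogenized points this means equal mass and equal weighted sum of points; it is the
    equality constraint of the linear program whose optimum is the lower hull. *)
Definition same_moment (mu nu : 'I_k -> R) :=
  forall l, \sum_i mu i * ev l i = \sum_i nu i * ev l i.

Lemma same_moment_mass mu nu :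
  same_moment mu nu -> \sum_i mu i = \sum_i nu i.
Proof.
move=> /(_ e1); under eq_bigr do rewrite ev_e1 mulr1.
by under [X in _ = X]eq_bigr do rewrite ev_e1 mulr1.
Qed.

(** [e1] fixes the total mass, which confines nonnegative solutions to a cube; the linear program
    thus has a minimizer. *)
Lemma feasible_compact (lam : 'I_k -> R) :
  compact [set mu : 'rV[R]_k |
    (forall i, 0 <= mu 0 i) /\ same_moment (fun i => mu 0 i) lam].
Proof.
pose T := \sum_i lam i.
apply: (@subclosed_compact _ _ [set mu : 'rV[R]_k | forall i, `[0, T]%classic (mu 0 i)]).
- have -> : [set mu : 'rV[R]_k | (forall i, 0 <= mu 0 i) /\ same_moment (fun i => mu 0 i) lam]
    = (\bigcap_(i in setT) [set mu : 'rV[R]_k | 0 <= mu 0 i]) `&`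
      \bigcap_(l in setT) [set mu : 'rV[R]_k | \sum_i mu 0 i * ev l i = \sum_i lam i * ev l i].
    apply/seteqP; split=> mu /= [H1 H2]; split.
    - by move=> i _; apply: H1.
    - by move=> l _; apply: H2.
    - by move=> i; apply: (H1 i).
    - by move=> l; apply: (H2 l).
  apply: closedI; apply: closed_bigI => i _.
  + apply: (@closed_comp_continuous _ _ (fun mu : 'rV[R]_k => mu 0 i) [set x | 0 <= x]).
      exact: continuous_coord.
    exact: closed_ge.
  + apply: (@closed_comp_continuous _ _ (fun mu : 'rV[R]_k => \sum_j mu 0 j * ev i j)
      [set x | x = \sum_j lam j * ev i j]); last exact: closed_eq.
    apply: (@continuous_bigsum R R^o) => j _.
    by apply: continuous_mulr; apply: continuous_coord.
- by apply: (@rV_compact R k (fun=> `[0, T]%classic)) => i; apply: segment_compact.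
move=> mu /= [mu0 muG] i; rewrite in_itv /= mu0 /=.
rewrite /T -(same_moment_mass muG) (bigD1 i) //= lerDl.
exact: sumr_ge0.
Qed.

(** A cheapest measure [c] exists by compactness, and Farkas supplies a dual function tight on its
    support. The pair [(l, t)] homogenizes the dual: a solution with [t < 0], divided by [- t], lies
    below [w], and the constraint from [psi] says that its total slack against [c] is at most
    zero. *)
Lemma lp_duality (lam : 'I_k -> R) (w : 'rV[R]_k) : (forall i, 0 <= lam i) ->
  exists (mu : 'I_k -> R) (l : 'rV[R]_p),
    [/\ forall i, 0 <= mu i, same_moment mu lam, below l w &
        forall i, i \notin contact l w -> mu i = 0].
Proof.
move=> lam0.
pose D := [set mu : 'rV[R]_k |
    (forall i, 0 <= mu 0 i) /\ same_moment (fun i => mu 0 i) lam].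
have D0 : D !=set0.
  exists (\row_i lam i); split=> [i|l]; first by rewrite mxE.
  by apply: eq_bigr => i _; rewrite mxE.
pose cost (mu : 'rV[R]_k) := \sum_i mu 0 i * w 0 i.
have ccost : {within D, continuous cost}.
  apply: continuous_subspaceT; apply: (@continuous_bigsum R R^o) => i _.
  by apply: continuous_mulr; apply: continuous_coord.
have [c cD cmin] := EVT_min_rV D0 (@feasible_compact lam) ccost.
move: cD; rewrite inE => -[c0 cG].
pose phi (i : 'I_k) (x : 'rV[R]_p * R^o) : R := ev x.1 i + x.2 * w 0 i.
have philin i : is_lin (phi i).
  by move=> a x y; rewrite /phi /= evD evZ /=; rewrite /GRing.scale /=; ring.
pose psi x := - \sum_i c 0 i * phi i x.
have psilin : is_lin psi.
  move=> a x y; rewrite /psi; under eq_bigr do rewrite philin mulrDr mulrCA.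
  by rewrite big_split /= -mulr_sumr; ring.
pose snd_ (x : 'rV[R]_p * R^o) : R := x.2.
have sndlin : is_lin snd_ by move=> a x y.
pose fam (i : 'I_(k + 2)) : 'rV[R]_p * R^o -> R := match fintype.split i with
  | inl j => phi j | inr j => if j == 0 then psi else snd_ end.
have famlin i : is_lin (fam i).
  by rewrite /fam; case: (fintype.split i) => // j; case: ifP.
have blin : is_lin (fun x => - snd_ x).
  by move=> a x y; rewrite sndlin; ring.
have [Hall|] := pselect (forall x, (forall i, fam i x <= 0) -> - snd_ x <= 0).
  have [y [y0 yb]] := farkas famlin blin Hall.
  exfalso.
  (* The certificate gives a direction [nu] with zero moments along which the cost changes at rate
     [- 1 - y2], so [c] could be improved. *)
  pose y1 := y (rshift k 0); pose y2 := y (rshift k 1).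
  pose nu i := y (lshift 2 i) - y1 * c 0 i.
  have nub x : - snd_ x = \sum_i nu i * phi i x + y2 * snd_ x.
    rewrite yb big_split_ord /= big_ord_recl big_ord1.
    have -> : fam (rshift k 0) = psi by rewrite /fam (unsplitK (inr 0)).
    have -> : lift ord0 (ord0 : 'I_1) = 1 :> 'I_2 by apply/val_inj.
    have -> : fam (rshift k 1) = snd_ by rewrite /fam (unsplitK (inr 1)).
    rewrite addrA -/y1 -/y2; congr (_ + _).
    rewrite /psi mulrN mulr_sumr -sumrB; apply: eq_bigr => i _.
    by rewrite /fam (unsplitK (inl i)) /nu; ring.
  have nu0 l : \sum_i nu i * ev l i = 0.
    have := nub (l, 0); rewrite /snd_ /= oppr0 mulr0 addr0 => {2}->.
    by apply: eq_bigr => i _; rewrite /phi /= mul0r addr0.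
  have nuw : \sum_i nu i * w 0 i = - 1 - y2.
    have := nub (0, 1); rewrite /snd_ /= mulr1.
    under eq_bigr do rewrite /phi /= /ev mul0mx mxE add0r mul1r.
    by move=> ->; ring.
  have y10 : 0 <= y1 by apply: y0.
  have y20 : 0 <= y2 by apply: y0.
  (* Chosen so that [eps * y1 <= 1]: only the part [- y1 * c] of [nu] is negative, hence
     [c + eps * nu] stays nonnegative. *)
  pose eps := (1 + y1)^-1.
  have eps0 : 0 < eps by rewrite invr_gt0 ltr_wpDr.
  have epsy : eps * y1 <= 1 by rewrite mulrC ler_pdivrMr ?mul1r ?lerDr ?ltr_wpDr.
  pose c' : 'rV[R]_k := \row_i (c 0 i + eps * nu i).
  have : cost c <= cost c'.
    apply: cmin; rewrite inE; split=> [i|l].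
      rewrite mxE /nu.
      have -> : c 0 i + eps * (y (lshift 2 i) - y1 * c 0 i)
        = c 0 i * (1 - eps * y1) + eps * y (lshift 2 i) by ring.
      by rewrite addr_ge0 // mulr_ge0 // ?subr_ge0 // ltW.
    under eq_bigr do rewrite mxE mulrDl -mulrA.
    by rewrite big_split /= -mulr_sumr nu0 mulr0 addr0.
  rewrite /cost; under [X in _ <= X]eq_bigr do rewrite mxE mulrDl -mulrA.
  rewrite big_split /= -mulr_sumr nuw lerDl pmulr_rge0 //; lra.
move=> /existsNP[[l t] /not_implyP[fle /negP]]; rewrite -ltNge /snd_ /= oppr_gt0 => t0.
have Hphi i : ev l i + t * w 0 i <= 0.
  by have := fle (lshift 2 i); rewrite /fam (unsplitK (inl i)).
have Hpsi : 0 <= \sum_i c 0 i * (ev l i + t * w 0 i).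
  by have := fle (rshift k 0); rewrite /fam (unsplitK (inr 0)) /= oppr_le0.
exists (fun i => c 0 i), ((- t)^-1 *: l).
have s0 : 0 < (- t)^-1 by rewrite invr_gt0 oppr_gt0.
have evE i : ev ((- t)^-1 *: l) i = w 0 i + (- t)^-1 * (ev l i + t * w 0 i).
  by rewrite evZ; field; rewrite lt_eqF.
split=> //.
  by move=> i; rewrite evE gerDl pmulr_rle0.
move=> i; rewrite inE evE -subr_eq0 addrC addKr mulf_eq0 (gt_eqF s0) /= => ne0.
have : \sum_i c 0 i * - (ev l i + t * w 0 i) = 0.
  apply/eqP; rewrite eq_le; apply/andP; split; last first.
    by apply: sumr_ge0 => j _; rewrite mulr_ge0 // oppr_ge0.
  by under eq_bigr do rewrite mulrN; rewrite sumrN oppr_le0.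
move/eqP; rewrite psumr_eq0; last first.
  by move=> j _; rewrite mulr_ge0 // oppr_ge0.
move=> /allP /(_ i (mem_index_enum _)) /=; rewrite mulf_eq0 oppr_eq0 (negPf ne0) orbF.
by move/eqP.
Qed.

End SecondaryFan.

(** * Patterns and gap functions *)

Section Patterns.
Variables (R : realType) (p k : nat) (G : 'M[R]_(p, k)).
Variable e1 : 'rV[R]_p.
Hypothesis e1G : forall i, (e1 *m G) 0 i = 1.

Local Notation ev := (ev G).
Local Notation below := (below G).
Local Notation contact := (contact G).
Local Notation same_moment := (same_moment G).
Local Notation pattern := {set {set 'I_k}}.

Lemma ev_row (l : 'rV[R]_p) : l *m G = \row_i ev l i.
Proof. by apply/rowP => i; rewrite [RHS]mxE. Qed.

Lemma complementary_slackness mu l w :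
  (forall i, i \notin contact l w -> mu i = 0) ->
  \sum_i mu i * w 0 i = \sum_i mu i * ev l i.
Proof.
move=> mu0; apply: eq_bigr => i _.
have [|/mu0 ->] := boolP (i \in contact l w); last by rewrite !mul0r.
by rewrite inE => /eqP ->.
Qed.

Lemma weak_duality mu nu l w : (forall i, 0 <= mu i) -> same_moment mu nu ->
  below l w -> \sum_i nu i * ev l i <= \sum_i mu i * w 0 i.
Proof.
by move=> mu0 mm lw; rewrite -mm; apply: ler_sum => i _; rewrite ler_wpM2l.
Qed.

Lemma tight_support mu l w : (forall i, 0 <= mu i) -> below l w ->
  \sum_i mu i * w 0 i = \sum_i mu i * ev l i ->
  forall i, 0 < mu i -> i \in contact l w.
Proof.
move=> mu0 lw /eqP; rewrite -subr_eq0 -sumrB.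
under eq_bigr do rewrite -mulrBr.
rewrite psumr_eq0 => [/allP H i mui|i _]; last by rewrite mulr_ge0 // subr_ge0.
have := H i (mem_index_enum _); rewrite /= mulf_eq0 (gt_eqF mui) /= subr_eq0.
by rewrite inE eq_sym.
Qed.

Lemma optimal_value_unique mu mu' l l' w :
  (forall i, 0 <= mu i) -> (forall i, 0 <= mu' i) ->
  below l w -> below l' w ->
  (forall i, i \notin contact l w -> mu i = 0) ->
  (forall i, i \notin contact l' w -> mu' i = 0) ->
  same_moment mu mu' ->
  \sum_i mu i * w 0 i = \sum_i mu' i * w 0 i.
Proof.
move=> mu0 mu0' lw lw' s s' mm; apply/eqP; rewrite eq_le; apply/andP; split.
  by rewrite (complementary_slackness s) mm; apply: weak_duality.
rewrite (complementary_slackness s') -mm; apply: weak_duality => //.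
Qed.

Implicit Types (s : {set 'I_k}) (w : 'rV[R]_k).

Definition indic (s : {set 'I_k}) (i : 'I_k) : R := (i \in s)%:R.

Lemma indic_ge0 s i : 0 <= indic s i. Proof. exact: ler0n. Qed.

Lemma hull_ex s w : exists v, exists mu l,
  [/\ forall i, 0 <= mu i, same_moment mu (indic s), below l w,
      forall i, i \notin contact l w -> mu i = 0 & v = \sum_i mu i * w 0 i].
Proof.
have [|mu [l [mu0 mm lw sl]]] := @lp_duality R p k G e1 e1G (indic s) w.
  by move=> i; rewrite ler0n.
by exists (\sum_i mu i * w 0 i), mu, l.
Qed.

(** For homogenized points and nonempty [s] this is [#|s|] times the lower hull of [w] at the
    barycenter of [s]. The choice is harmless by [optimal_value_unique]. *)
Definition hull s w : R := projT1 (cid (hull_ex s w)).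

Lemma hullE s w mu l : (forall i, 0 <= mu i) -> same_moment mu (indic s) ->
  below l w -> (forall i, i \notin contact l w -> mu i = 0) ->
  hull s w = \sum_i mu i * w 0 i.
Proof.
move=> mu0 mm lw sl; rewrite /hull; case: cid => v /= [nu [l' [nu0 nm lw' sl' ->]]].
by apply: optimal_value_unique sl' sl _ => // l0; rewrite mm nm.
Qed.

Lemma hullP s w : exists mu l,
  [/\ forall i, 0 <= mu i, same_moment mu (indic s), below l w,
      forall i, i \notin contact l w -> mu i = 0 & hull s w = \sum_i mu i * w 0 i].
Proof.
have [v [mu [l [mu0 mm lw sl _]]]] := hull_ex s w.
by exists mu, l; split=> //; apply: hullE sl.
Qed.

Lemma hull_le s w mu : (forall i, 0 <= mu i) -> same_moment mu (indic s) ->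
  hull s w <= \sum_i mu i * w 0 i.
Proof.
move=> mu0 mm; have [nu [l [nu0 nm lw sl ->]]] := hullP s w.
by rewrite (complementary_slackness sl) nm -mm; apply: weak_duality.
Qed.

Definition gap s w : R := \sum_i indic s i * w 0 i - hull s w.

(** Recording all subsets of contacts makes patterns closed downwards, so that coarsening becomes
    plain inclusion. *)
Definition pat (w : 'rV[R]_k) : pattern :=
  [set s : {set 'I_k} | `[<exists l, below l w /\ s \subset contact l w>]].

Lemma patP s w :
  reflect (exists l, below l w /\ s \subset contact l w) (s \in pat w).
Proof. by rewrite inE; apply: asboolP. Qed.

Lemma pat_sub s s' w : s \subset s' -> s' \in pat w -> s \in pat w.
Proof.
move=> ss /patP[l [lw sl]]; apply/patP; exists l; split=> //.
exact: fintype.subset_trans ss sl.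
Qed.

Lemma indic_off (s S : {set 'I_k}) : s \subset S ->
  forall i, i \notin S -> indic s i = 0.
Proof.
by move=> sS i; rewrite /indic; apply: contraNeq; rewrite pnatr_eq0 eqb0 negbK => /(fintype.subsetP sS).
Qed.

Lemma gap_ge0 s w : 0 <= gap s w.
Proof. by rewrite subr_ge0 hull_le //; exact: indic_ge0. Qed.

(** Equality of primal and dual values: if [indic s] is itself optimal, the dual function is tight
    on its support [s]. *)
Lemma gap_eq0 s w : (gap s w == 0) = (s \in pat w).
Proof.
rewrite subr_eq0; apply/eqP/patP => [|[l [lw sl]]]; last first.
  by rewrite (@hullE s w (indic s) l) //; exact: indic_off.
have [mu [l [mu0 mm lw sl ->]]] := hullP s w => eqv.
exists l; split=> //; apply/fintype.subsetP => i si.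
apply: (@tight_support (indic s)) => //.
- by rewrite eqv -mm (complementary_slackness sl).
- by rewrite /indic si.
Qed.

(** A measure optimal for [w'] is feasible for [w], and each of its weights is at most its mass
    [#|s|], hence at most [k]. *)
Lemma hull_lip s w w' :
  hull s w <= hull s w' + \sum_i k%:R * `|w 0 i - w' 0 i|.
Proof.
have [mu [l [mu0 mm lw sl ->]]] := hullP s w'.
apply: (le_trans (hull_le w mu0 mm)).
rewrite -lerBlDl -sumrB; apply: ler_sum => i _; rewrite -mulrBr.
apply: (@le_trans _ _ (mu i * `|w 0 i - w' 0 i|)).
  by rewrite ler_wpM2l // ler_norm.
rewrite ler_wpM2r //; apply: (@le_trans _ _ (\sum_j mu j)).
  by rewrite (bigD1 i) //= lerDl sumr_ge0.
rewrite (same_moment_mass e1G mm).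
rewrite -[k in leRHS]card_ord -sum1_card natr_sum; apply: ler_sum => j _.
by rewrite /indic ler_nat leq_b1.
Qed.

Lemma gap_continuous s : continuous (gap s).
Proof.
have hull_cont : continuous (hull s).
  apply: (@continuous_modulus _ _ _ (fun w w' => \sum_i `|w 0 i - w' 0 i| * k%:R)).
  - move=> w; apply: (@continuous_bigsum R R^o) => i _.
    apply: continuous_mulr; apply: continuous_normB; exact: continuous_coord.
  - by move=> w; rewrite big1 // => i _; rewrite subrr normr0 mul0r.
  - by move=> w w'; under eq_bigr do rewrite mulrC; apply: hull_lip.
  - by move=> w w'; under eq_bigr do rewrite mulrC distrC; apply: hull_lip.
apply: continuous_subr => //.
apply: (@continuous_bigsum R R^o) => i _.
have -> : (fun w : 'rV[R]_k => indic s i * w 0 i) = (fun w => w 0 i * indic s i).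
  by apply/funext => w; rewrite mulrC.
apply: continuous_mulr; exact: continuous_coord.
Qed.

Lemma mem_pat_contact w (s : {set 'I_k}) l : below l w -> s \subset contact l w -> s \in pat w.
Proof. by move=> lw sl; apply/patP; exists l. Qed.

Lemma gapE w s mu l : (forall i, 0 <= mu i) -> same_moment mu (indic s) ->
  below l w -> (forall i, i \notin contact l w -> mu i = 0) ->
  gap s w = \sum_i (indic s i - mu i) * w 0 i.
Proof.
move=> mu0 mm lw sl; rewrite /gap (hullE mu0 mm lw sl) -sumrB.
by apply: eq_bigr => i _; rewrite mulrBl.
Qed.

(* A measure that is optimal for [w0] stays optimal for every [w] whose pattern
   contains that of [w0]. *)
Lemma optimal_common s w0 : exists mu : 'I_k -> R,
  forall w, pat w0 \subset pat w -> gap s w = \sum_i (indic s i - mu i) * w 0 i.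
Proof.
have [mu [l [mu0 mm lw sl _]]] := hullP s w0; exists mu => w sub.
have /(fintype.subsetP sub)/patP[l' [lw' sl']] := mem_pat_contact lw (subxx _).
apply: (gapE mu0 mm lw') => i inl; apply: sl; apply: contra inl.
exact: (fintype.subsetP sl').
Qed.

Lemma contactD l l' w w' : contact l w :&: contact l' w' \subset contact (l + l') (w + w').
Proof.
apply/fintype.subsetP => i; rewrite !inE => /andP[/eqP e /eqP e'].
by rewrite evD e e' mxE.
Qed.

Lemma pat_addl w0 w w' : pat w0 \subset pat w -> pat w0 \subset pat w' ->
  pat w0 \subset pat (w + w').
Proof.
move=> sub sub'; apply/fintype.subsetP => s /patP[l0 [l0w s0]].
have /(fintype.subsetP sub)/patP[l [lw sl]] := mem_pat_contact l0w (subxx _).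
have /(fintype.subsetP sub')/patP[l' [lw' sl']] := mem_pat_contact l0w (subxx _).
apply: (@mem_pat_contact _ _ (l + l')).
  by move=> i; rewrite evD mxE lerD.
apply: fintype.subset_trans s0 (fintype.subset_trans _ (contactD _ _ _ _)).
by rewrite finset.subsetI sl sl'.
Qed.

Lemma contactZ c l w : contact l w \subset contact (c *: l) (c *: w).
Proof.
by apply/fintype.subsetP => i; rewrite !inE => /eqP e; rewrite evZ e mxE.
Qed.

Lemma pat_scale_sub c w : 0 <= c -> pat w \subset pat (c *: w).
Proof.
move=> c0; apply/fintype.subsetP => s /patP[l [lw sl]].
apply: (@mem_pat_contact _ _ (c *: l)); last exact: fintype.subset_trans sl (contactZ _ _ _).
by move=> i; rewrite evZ mxE ler_wpM2l.
Qed.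

Lemma pat_scale c w : 0 < c -> pat (c *: w) = pat w.
Proof.
move=> c0; apply/eqP; rewrite finset.eqEsubset pat_scale_sub ?(ltW c0) // andbT.
by rewrite -{2}(scalerK (lt0r_neq0 c0) w) pat_scale_sub // invr_ge0 ltW.
Qed.

Lemma pat_shift l w : pat (w + l *m G) = pat w.
Proof.
apply/setP => s; apply/patP/patP => -[l' [lw sl]].
  exists (l' - l); split=> [i|].
    by rewrite evB lerBlDr (le_trans (lw i)) // ev_row !mxE.
  apply: (fintype.subset_trans sl); apply/fintype.subsetP => i; rewrite !inE => /eqP e.
  by rewrite evB e ev_row !mxE addrK.
exists (l' + l); split=> [i|].
  by rewrite evD ev_row !mxE lerD.
apply: (fintype.subset_trans sl); apply/fintype.subsetP => i; rewrite !inE => /eqP e.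
by rewrite evD e ev_row !mxE.
Qed.

(** This identifies the lineality space of the fan, which the order complex must avoid. *)
Lemma patT w : pat w = [set: {set 'I_k}]%SET <-> (w <= G)%MS.
Proof.
split=> [patw|/submxP[l ->]].
  have /patP[l [lw sl]] : [set: 'I_k]%SET \in pat w by rewrite patw inE.
  apply/submxP; exists l; apply/rowP => i.
  by have := fintype.subsetP sl i; rewrite !inE => /(_ isT)/eqP.
apply/setP => s; rewrite finset.in_setT; apply/patP; exists l; split=> [i|].
  exact: lexx.
by apply/fintype.subsetP => i _; rewrite inE.
Qed.

Lemma gap_shift s l w : gap s (w + l *m G) = gap s w.
Proof.
have [mu [l' [mu0 mm lw sl]]] := hullP s w; rewrite /gap => ->.
rewrite (@hullE s _ mu (l' + l)) //.
- rewrite -!sumrB; under eq_bigr do rewrite -mulrBl ev_row !mxE mulrDr.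
  rewrite big_split /= addrC -[RHS]add0r; congr (_ + _); last first.
    by apply: eq_bigr => i _; rewrite mulrBl.
  under eq_bigr do rewrite mulrBl.
  by rewrite sumrB mm subrr.
- by move=> i; rewrite evD ev_row !mxE lerD.
- move=> i H; apply: sl; apply: contra H; rewrite !inE => /eqP e.
  by rewrite evD e ev_row !mxE.
Qed.

(** One measure computes the hull for every height in the closed cone of [w0], and that cone is
    stable under nonnegative combinations. *)
Lemma gap_lin w0 s c c' w w' : pat w0 \subset pat w -> pat w0 \subset pat w' ->
  0 <= c -> 0 <= c' ->
  gap s (c *: w + c' *: w') = c * gap s w + c' * gap s w'.
Proof.
move=> sub sub' c0 c0'.
have [mu Hmu] := optimal_common s w0.
rewrite !Hmu ?mulr_sumr // -?big_split /=; last first.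
  apply: pat_addl; [apply: fintype.subset_trans sub _|apply: fintype.subset_trans sub' _];
  exact: pat_scale_sub.
by apply: eq_bigr => i _; rewrite !mxE; ring.
Qed.

Lemma set0_pat w : finset.set0 \in pat w.
Proof.
have [mu [l [_ _ lw _ _]]] := hullP finset.set0 w.
by apply: mem_pat_contact lw _; rewrite finset.sub0set.
Qed.

(* [c] is the least ratio of slacks over the pairs (maximal set of the
   pattern, index outside it). *)
Lemma peel w0 w : pat w = pat w0 -> pat w0 != [set: {set 'I_k}]%SET ->
  exists2 c, 0 < c & pat w0 \proper pat (w - c *: w0).
Proof.
move=> ww0 neT.
(* Every set of the pattern lies in a member of [M], and a function from below that is tight on a
   member is tight nowhere else. *)
pose M := [set s in pat w0 | [forall s' in pat w0, (s \subset s') ==> (s' == s)]].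
have Mex s : s \in pat w0 -> exists2 s', s' \in M & s \subset s'.
  move=> sp; have [s' /maxsetP[s'p s'max] ss'] := @maxset_exists _ (mem (pat w0)) s sp.
  exists s' => //; rewrite inE; apply/andP; split=> //; apply/forall_inP => t tp; apply/implyP => st.
  by apply/eqP/s'max.
have Ml (v : 'rV[R]_k) (s : {set 'I_k}) : pat v = pat w0 -> s \in M ->
    exists2 l, below l v & contact l v = s.
  move=> pv; rewrite inE => /andP[sp /forall_inP smax].
  move: (sp); rewrite -pv => /patP[l [lv sl]]; exists l => //; apply/eqP.
  by apply: (implyP (smax _ _)) => //; rewrite -pv; apply: mem_pat_contact lv _.
have Mc (v : 'rV[R]_k) : pat v = pat w0 ->
    forall s, exists l, s \in M -> below l v /\ contact l v = s.
  move=> pv s; have [sM|] := boolP (s \in M); last by exists 0.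
  by have [l lw cl] := Ml v s pv sM; exists l.
have [L0 HL0] := choice (Mc w0 erefl).
have [L HL] := choice (Mc w ww0).
pose sl0 (x : {set 'I_k} * 'I_k) := w0 0 x.2 - ev (L0 x.1) x.2.
pose sl (x : {set 'I_k} * 'I_k) := w 0 x.2 - ev (L x.1) x.2.
pose P (x : {set 'I_k} * 'I_k) := (x.1 \in M) && (x.2 \notin x.1).
have sl0_gt0 x : P x -> 0 < sl0 x.
  move=> /andP[xM xn]; have [H1 H2] := HL0 _ xM.
  by rewrite subr_gt0 lt_neqAle H1 andbT; move: xn; rewrite -{1}H2 inE.
have sl_gt0 x : P x -> 0 < sl x.
  move=> /andP[xM xn]; have [H1 H2] := HL _ xM.
  by rewrite subr_gt0 lt_neqAle H1 andbT; move: xn; rewrite -{1}H2 inE.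
have [x0 Px0] : exists x, P x.
  have [s sM _] := Mex _ (set0_pat w0).
  have [i ins|all] := pickP [pred i | i \notin s]; first by exists (s, i); rewrite /P sM.
  case/eqP: neT; apply/setP => t; rewrite finset.in_setT.
  move: sM; rewrite inE => /andP[sp _]; apply: (pat_sub _ sp).
  by apply/fintype.subsetP => i _; move: (all i) => /= /negbFE.
pose x1 := [arg min_(x < x0 | P x) (sl x / sl0 x)]%O.
have [Px1 x1min] : P x1 /\ forall x, P x -> sl x1 / sl0 x1 <= sl x / sl0 x.
  by rewrite /x1; case: arg_minP => // x Px H; split.
pose c := sl x1 / sl0 x1.
have c0 : 0 < c by rewrite divr_gt0 ?sl_gt0 ?sl0_gt0.
exists c => //.
have bel s : s \in M -> below (L s - c *: L0 s) (w - c *: w0).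
  move=> sM i; have [H1 H2] := HL _ sM; have [H3 H4] := HL0 _ sM.
  rewrite evB evZ !mxE.
  have [iS|iS] := boolP (i \in s).
    have : i \in contact (L s) w by rewrite H2.
    have : i \in contact (L0 s) w0 by rewrite H4.
    by rewrite !inE => /eqP-> /eqP->.
  have Px : P (s, i) by rewrite /P sM.
  have := x1min _ Px; rewrite ler_pdivlMr ?sl0_gt0 // -/c /sl /sl0 /=.
  by move=> H; lra.
have con s : s \in M -> s \subset contact (L s - c *: L0 s) (w - c *: w0).
  move=> sM; apply/fintype.subsetP => i iS.
  have [_ H2] := HL _ sM; have [_ H4] := HL0 _ sM.
  have : i \in contact (L s) w by rewrite H2.
  have : i \in contact (L0 s) w0 by rewrite H4.
  by rewrite !inE evB evZ !mxE => /eqP-> /eqP->.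
rewrite properE; apply/andP; split.
  apply/fintype.subsetP => s /Mex[s' s'M ss'].
  by apply: pat_sub ss' _; apply: mem_pat_contact (bel _ s'M) (con _ s'M).
case/andP: Px1 => xM xn.
(* At the minimizing pair the outside index becomes tight together with its maximal set, and their
   union is new to the pattern. *)
apply/negP => /fintype.subsetP /(_ (x1.2 |: x1.1)).
have -> : x1.2 |: x1.1 \in pat (w - c *: w0).
  apply: mem_pat_contact (bel _ xM) _; rewrite finset.subUset con // andbT finset.sub1set inE evB evZ !mxE.
  have := @sl0_gt0 x1; rewrite /P xM xn => /(_ isT) s0.
  have : c * sl0 x1 = sl x1 by rewrite /c divfK // gt_eqF.
  by rewrite /sl /sl0 => H; apply/eqP; lra.
move=> /(_ isT); move: xM; rewrite inE => /andP[_ /forall_inP smax] /smax.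
rewrite finset.subsetU1 /= => /eqP e.
by have := finset.setU11 x1.2 x1.1; rewrite e (negPf xn).
Qed.

End Patterns.

(** * Barycentric coordinates of the fan *)

Section Coordinates.
Variables (R : realType) (p k : nat) (G : 'M[R]_(p, k)).
Variable e1 : 'rV[R]_p.
Hypothesis e1G : forall i, (e1 *m G) 0 i = 1.

Local Notation pattern := {set {set 'I_k}}.
Local Notation patT_ := [set: {set 'I_k}]%SET.
Local Notation gap := (gap e1G).
Local Notation pat := (pat G).
Implicit Types (s : {set 'I_k}) (w : 'rV[R]_k) (Z : pattern) (t : pattern -> R).

(** Linear on each closed cone and zero only on the lineality space, it serves as the size of a
    height vector. *)
Definition total w : R := \sum_s gap s w.

Lemma total_ge0 w : 0 <= total w.
Proof. by apply: sumr_ge0 => s _; apply: gap_ge0. Qed.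

Lemma total_gt0 w : pat w != patT_ -> 0 < total w.
Proof.
move=> neT; rewrite lt0r total_ge0 andbT; apply: contra neT.
rewrite psumr_eq0 => [/allP H|s _]; last exact: gap_ge0.
apply/eqP/setP => s; rewrite finset.in_setT -(gap_eq0 e1G).
exact: (H s (mem_index_enum _)).
Qed.

Lemma gap_scale s c w : 0 <= c -> gap s (c *: w) = c * gap s w.
Proof.
move=> c0; have := @gap_lin _ _ _ _ _ e1G w s c 0 w w (subxx _) (subxx _) c0 (lexx _).
by rewrite scale0r addr0 mul0r addr0.
Qed.

Lemma total_scale c w : 0 <= c -> total (c *: w) = c * total w.
Proof.
by move=> c0; rewrite /total mulr_sumr; apply: eq_bigr => s _; apply: gap_scale.
Qed.

Lemma pat0 : pat 0 = patT_.
Proof. by apply/patT; apply: sub0mx. Qed.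

Lemma gap0 s : gap s 0 = 0.
Proof. by apply/eqP; rewrite gap_eq0 pat0 finset.in_setT. Qed.

Definition realizable Z : bool := `[<exists w, pat w = Z>] && (Z != patT_).

(** One point of size 1 in each open cone: the vertices of the barycentric subdivision of the
    fan. *)
Definition rep Z : 'rV[R]_k :=
  if pselect (exists w, pat w = Z) is left H
  then let w := projT1 (cid H) in (total w)^-1 *: w else 0.

Lemma realizable_pat w : pat w != patT_ -> realizable (pat w).
Proof. by move=> neT; rewrite /realizable neT andbT; apply/asboolP; exists w. Qed.

Lemma rep_pat Z : realizable Z -> pat (rep Z) = Z.
Proof.
move=> /andP[/asboolP HZ ZT]; rewrite /rep; case: pselect => // H.
case: cid => w wZ /=; rewrite pat_scale // invr_gt0 total_gt0 //.
by rewrite wZ.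
Qed.

Lemma rep_total Z : realizable Z -> total (rep Z) = 1.
Proof.
move=> /andP[/asboolP HZ ZT]; rewrite /rep; case: pselect => // H.
case: cid => w wZ /=; have t0 : 0 < total w by rewrite total_gt0 // wZ.
by rewrite total_scale ?invr_ge0 ?ltW // mulVf // gt_eqF.
Qed.

(** A point of the cone over the order complex of the realizable patterns. The mass is left free
    because [peel] produces the weights one at a time. *)
Definition chain_weights t :=
  [/\ forall Z, 0 <= t Z, forall Z, ~~ realizable Z -> t Z = 0 &
      forall Z Z', 0 < t Z -> 0 < t Z' -> Z \subset Z' \/ Z' \subset Z].

Definition Phi t : 'rV[R]_k := \sum_Z t Z *: rep Z.

Definition rep_gap t s : R := \sum_Z t Z * gap s (rep Z).

Lemma chain_realizable t Z : chain_weights t -> 0 < t Z -> realizable Z.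
Proof.
by move=> [_ t0 _]; apply: contraTT => /t0 ->; rewrite ltxx.
Qed.

(** All representatives in the support lie in the closed cone of [w0], where gaps are additive, so
    the sum is built up term by term. *)
Lemma Phi_common w0 t : chain_weights t -> (forall Z, 0 < t Z -> pat w0 \subset Z) ->
  pat w0 \subset pat (Phi t) /\ forall s, gap s (Phi t) = rep_gap t s.
Proof.
move=> tc tw; have [t0 _ _] := tc; rewrite /Phi /rep_gap.
elim: (index_enum _) => [|Z r [IH1 IH2]].
  by rewrite big_nil pat0 finset.subsetT; split=> // s; rewrite big_nil gap0.
have [Z0|Z0] := eqVneq (t Z) 0.
  rewrite big_cons Z0 scale0r add0r; split=> // s.
  by rewrite big_cons Z0 mul0r add0r.
have tZ : 0 < t Z by rewrite lt0r Z0 t0.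
have rZ := chain_realizable tc tZ.
have sub : pat w0 \subset pat (rep Z) by rewrite rep_pat // tw.
rewrite big_cons; split=> [|s].
  by apply: pat_addl => //; rewrite pat_scale.
rewrite big_cons -IH2 -[X in gap s (_ + X)]scale1r (gap_lin e1G s sub IH1) //.
by rewrite mul1r.
Qed.

(** A sum of nonnegative gaps vanishes exactly when [s] is in every pattern of the support, and the
    smallest one decides. *)
Lemma rep_gap_eq0 t Z0 s : chain_weights t -> 0 < t Z0 ->
  (forall Z, 0 < t Z -> Z0 \subset Z) -> (rep_gap t s == 0) = (s \in Z0).
Proof.
move=> tc tZ0 min; have [t0 _ _] := tc.
rewrite /rep_gap psumr_eq0 => [|Z _]; last by rewrite mulr_ge0 // gap_ge0.
apply/allP/idP => [/(_ Z0 (mem_index_enum _))|sZ0 Z _] /=.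
  by rewrite mulf_eq0 gt_eqF //= gap_eq0 rep_pat // (chain_realizable tc).
rewrite mulf_eq0; have [//|Zn0] := eqVneq (t Z) 0.
have tZ : 0 < t Z by rewrite lt0r Zn0 t0.
by rewrite gap_eq0 rep_pat ?(chain_realizable tc) //= (fintype.subsetP (min _ tZ)).
Qed.

Lemma chain_min t Z1 : chain_weights t -> 0 < t Z1 ->
  exists2 Z0, 0 < t Z0 & forall Z, 0 < t Z -> Z0 \subset Z.
Proof.
move=> [t0 _ tc] tZ1.
case: (@arg_minnP _ Z1 (fun Z => 0 < t Z) (fun Z => #|Z|) tZ1) => Z0 tZ0 min.
exists Z0 => // Z tZ; have [//|sub] := tc _ _ tZ0 tZ.
have /eqP <- // : Z == Z0.
by rewrite eqEcard sub min.
Qed.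

Lemma pat_Phi t Z0 : chain_weights t -> 0 < t Z0 ->
  (forall Z, 0 < t Z -> Z0 \subset Z) -> pat (Phi t) = Z0.
Proof.
move=> tc tZ0 min; have rZ0 := chain_realizable tc tZ0.
have [|_ gP] := @Phi_common (rep Z0) t tc; first by rewrite rep_pat.
by apply/setP => s; rewrite -(gap_eq0 e1G) gP (rep_gap_eq0 _ tc tZ0 min).
Qed.

Lemma gap_Phi t s : chain_weights t -> gap s (Phi t) = rep_gap t s.
Proof.
move=> tc; have [[Z1 tZ1]|none] := pselect (exists Z, 0 < t Z).
  have [Z0 tZ0 min] := chain_min tc tZ1; have rZ0 := chain_realizable tc tZ0.
  by have [|_ ->] := @Phi_common (rep Z0) t tc; first by rewrite rep_pat.
have [|_ ->//] := @Phi_common 0 t tc.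
by move=> Z tZ; case: none; exists Z.
Qed.

(** Induction on the number of sets missing from the pattern: [peel] removes a multiple of
    [rep (pat w)], the rest has a strictly larger pattern, and [pat w] is put below the chain
    obtained for it. *)
Lemma coords_ex w : exists t,
  [/\ chain_weights t, forall Z, 0 < t Z -> pat w \subset Z &
      forall s, gap s w = rep_gap t s].
Proof.
have [n] := ubnP #|~: pat w|; elim: n w => // n IH w le_n.
have [wT|wT] := eqVneq (pat w) patT_.
  exists (fun=> 0); split; first by split=> // Z Z'; rewrite ltxx.
    by move=> Z; rewrite ltxx.
  move=> s; rewrite /rep_gap big1 => [|Z _]; last by rewrite mul0r.
  by apply/eqP; rewrite gap_eq0 wT finset.in_setT.
have rZ := realizable_pat wT; set Z := pat w in rZ *.
have [||c c0] := @peel _ _ _ _ _ e1G (rep Z) w; rewrite ?rep_pat //.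
set w' := w - _ => prop.
have [|t [tc tw' gt]] := IH w'.
  rewrite ltnS in le_n; apply: leq_trans le_n; apply: proper_card.
  by rewrite finset.properC.
have tZ : t Z = 0.
  have [t0 _ _] := tc; apply/eqP/negPn/negP => tZn.
  have /tw' : 0 < t Z by rewrite lt0r tZn t0.
  by move=> sub; move: prop; rewrite properE sub andbF.
exists (fun Z' => t Z' + c * (Z' == Z)%:R).
have pos Z' : 0 < t Z' + c * (Z' == Z)%:R -> Z' = Z \/ 0 < t Z'.
  by case: eqP => [->|_]; [left|rewrite mulr0 addr0; right].
have subZ Z' : 0 < t Z' + c * (Z' == Z)%:R -> Z \subset Z'.
  move=> /pos[->//|/tw' H]; exact: fintype.subset_trans (proper_sub prop) H.
have [t0 tnr tch] := tc; split.
- split=> [Z'|Z' Z'n|Z1 Z2 tZ1 tZ2].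
  + by rewrite addr_ge0 // mulr_ge0 ?ler0n // ltW.
  + by rewrite tnr // add0r; case: eqP => [e|_]; rewrite ?mulr0 //; rewrite e rZ in Z'n.
  + case: (pos _ tZ1) => [->|H1]; first by left; apply: subZ.
    case: (pos _ tZ2) => [->|H2]; first by right; apply: subZ.
    exact: tch.
- exact: subZ.
move=> s; rewrite -[w](subrK (c *: rep Z)) -/w' -[w']scale1r.
rewrite (@gap_lin _ _ _ _ _ e1G w s 1 c w' (rep Z)) ?ler01 ?ltW //; last first.
- by rewrite rep_pat.
- exact: proper_sub prop.
rewrite mul1r gt /rep_gap.
under [RHS]eq_bigr do rewrite mulrDl.
rewrite big_split /=; congr (_ + _).
rewrite (bigD1 Z) //= eqxx mulr1 big1 ?addr0 // => Z' /negPf->.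
by rewrite mulr0 mul0r.
Qed.

(** Once the common part is cancelled, the remainders have disjoint supports but equal gaps. Gaps
    determine the smallest pattern of a support, so both remainders cannot be nonzero; a lone
    nonzero one would have zero gaps and smallest pattern [patT_], which is not realizable. *)
Lemma coords_uniq_le t t' : chain_weights t -> chain_weights t' ->
  (forall s, rep_gap t s = rep_gap t' s) -> forall Z, t Z <= t' Z.
Proof.
move=> tc tc' eqg Z; rewrite leNgt; apply/negP => ltZ.
have chain_sub (u v : pattern -> R) : chain_weights u -> (forall Z, 0 <= v Z) ->
    chain_weights (fun Z => u Z - Num.min (u Z) (v Z)).
  move=> [u0 unr uch] v0.
  have pos Z' : 0 < u Z' - Num.min (u Z') (v Z') -> 0 < u Z'.
    by move=> H; apply: lt_le_trans H _; rewrite gerBl le_min u0 v0.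
  split=> [Z'|Z' Zn|Z1 Z2 /pos H1 /pos H2]; last exact: uch.
    by rewrite subr_ge0 ge_min lexx.
  by rewrite unr // min_l ?subrr.
have [t0 _ _] := tc; have [t0' _ _] := tc'.
pose u Z := t Z - Num.min (t Z) (t' Z).
pose u' Z := t' Z - Num.min (t' Z) (t Z).
have uc : chain_weights u by apply: chain_sub.
have uc' : chain_weights u' by apply: chain_sub.
have equ s : rep_gap u s = rep_gap u' s.
  rewrite /rep_gap; under eq_bigr do rewrite mulrBl.
  under [RHS]eq_bigr do rewrite mulrBl minC.
  by rewrite !sumrB -/(rep_gap t s) eqg.
have uZ : 0 < u Z by rewrite /u min_r ?ltW // subr_gt0.
have [Z0 uZ0 min0] := chain_min uc uZ.
have [[Z1 uZ1]|none] := pselect (exists Z, 0 < u' Z).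
  have [Z2 uZ2 min2] := chain_min uc' uZ1.
  have e : Z0 = Z2.
    apply/setP => s; rewrite -(rep_gap_eq0 s uc uZ0 min0) equ.
    exact: rep_gap_eq0.
  move: uZ0 uZ2; rewrite -e /u /u'.
  by case: (ltP (t Z0) (t' Z0)) => H; rewrite ?subrr ?ltxx // minC (min_l H) subrr ltxx.
have : Z0 = patT_.
  apply/setP => s; rewrite finset.in_setT -(rep_gap_eq0 s uc uZ0 min0) equ.
  rewrite /rep_gap big1 ?eqxx // => Z' _; have [u0' _ _] := uc'.
  have : u' Z' = 0 by apply/eqP/negPn/negP => H; case: none; exists Z'; rewrite lt0r H u0'.
  by move=> ->; rewrite mul0r.
by have := chain_realizable uc uZ0; rewrite /realizable => /andP[_ /eqP].
Qed.

Lemma coords_uniq t t' : chain_weights t -> chain_weights t' ->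
  (forall s, rep_gap t s = rep_gap t' s) -> t =1 t'.
Proof.
move=> tc tc' e Z; apply/eqP; rewrite eq_le; apply/andP; split.
  exact: coords_uniq_le.
by apply: coords_uniq_le => // s; rewrite e.
Qed.

Lemma sum_rep_gap t : chain_weights t -> \sum_s rep_gap t s = \sum_Z t Z.
Proof.
move=> tc; rewrite /rep_gap exchange_big /=; apply: eq_bigr => Z _.
rewrite -mulr_sumr -/(total _); have [rZ|rZ] := boolP (realizable Z).
  by rewrite rep_total // mulr1.
by have [_ -> //] := tc; rewrite mul0r.
Qed.

Lemma coords_normalized_ex w : pat w != patT_ -> exists t,
  [/\ chain_weights t, \sum_Z t Z = 1 & forall s, gap s w = total w * rep_gap t s].
Proof.
move=> /total_gt0 w0; have [t [tc _ tg]] := coords_ex w.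
have w1 : (total w)^-1 * total w = 1 by rewrite mulVf // gt_eqF.
have [t0 tnr tch] := tc.
exists (fun Z => (total w)^-1 * t Z); split.
- split=> [Z|Z /tnr ->|Z Z'].
  + by rewrite mulr_ge0 // invr_ge0 ltW.
  + by rewrite mulr0.
  + by rewrite !pmulr_rgt0 ?invr_gt0 //; apply: tch.
- rewrite -mulr_sumr -sum_rep_gap // -[RHS]w1 /total; congr (_ * _).
  by apply: eq_bigr => s _; rewrite tg.
move=> s; rewrite /rep_gap mulr_sumr tg; apply: eq_bigr => Z _.
by rewrite mulrA mulrA [total w * _]mulrC w1 mul1r.
Qed.

Lemma coords_min w t : pat w != patT_ -> chain_weights t -> \sum_Z t Z = 1 ->
  (forall s, gap s w = total w * rep_gap t s) ->
  0 < t (pat w) /\ forall Z, 0 < t Z -> pat w \subset Z.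
Proof.
move=> wT tc t1 tg; have w0 := total_gt0 wT.
have [t0 _ _] := tc.
have [Z1 tZ1] : exists Z, 0 < t Z.
  apply/not_existsP => none; move: (oner_neq0 R); rewrite -t1 big1 ?eqxx // => Z _.
  by apply/eqP/negPn/negP => H; apply: (none Z); rewrite lt0r H t0.
have [Z0 tZ0 min] := chain_min tc tZ1.
have -> // : pat w = Z0.
apply/setP => s; rewrite -(gap_eq0 e1G) tg mulf_eq0 gt_eqF //=.
exact: rep_gap_eq0.
Qed.

End Coordinates.

Lemma closed_graph_cvg (U V : topologicalType) (f : U -> V) (K : set V)
    (Gr : set (U * V)) (A : set U) :
  compact K -> closed Gr -> (forall x, A x -> K (f x) /\ Gr (x, f x)) ->
  (forall x y, A x -> K y -> Gr (x, y) -> y = f x) ->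
  {within A, continuous f}.
Proof.
move=> Kc Grc fGr uniq_f; apply/subspace_continuousP => x Ax W.
rewrite nbhsE => -[W' [W'o W'x] subW].
apply: (@filterS _ _ _ (f @^-1` W')); first by move=> u; apply: subW.
apply: contrapT => notW.
pose D := A `&` f @^-1` (~` W').
pose F := f @ within D (nbhs x).
have FP : ProperFilter F.
  apply: fmap_proper_filter; split; last exact: within_filter.
  rewrite /within /= => H; apply: notW; rewrite nbhs_simpl /within /=.
  apply: filterS H => u /= Hu Au; apply: contrapT => nW; apply: Hu; split=> //.
have FK : F K.
  rewrite /F /fmap /= /within /=; apply: nearW => u [Au _].
  by have [] := fGr u Au.
have [y [Ky cly]] := Kc F FP FK.
have yfx : y = f x.
  apply: uniq_f => //; apply: Grc => P [[P1 P2] [/= P1x P2y] P12].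
  have FP1 : F (f @` (P1 `&` D)).
    rewrite /F /fmap /= /within /=; apply: filterS P1x => u P1u Du.
    by exists u.
  have [z [[u [P1u [Au _]] fuz] P2z]] := cly _ _ FP1 P2y.
  exists (u, z); split; last by apply: P12.
  by rewrite -fuz; have [] := fGr u Au.
have FW : F (~` W').
  by rewrite /F /fmap /= /within /=; apply: nearW => u [].
have W'y : nbhs y W' by rewrite yfx; apply: open_nbhs_nbhs.
by have [z []] := cly _ _ FW W'y.
Qed.

(** * Continuity on subsets *)

Section WithinContinuity.
Variables (K : numFieldType) (T : topologicalType) (A : set T).

Lemma within_comp (U V : topologicalType) (B : set U) (f : T -> U) (g : U -> V) :
  {within A, continuous f} -> (forall x, A x -> B (f x)) ->
  {within B, continuous g} -> {within A, continuous (g \o f)}.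
Proof.
move=> /subspace_continuousP fc fAB /subspace_continuousP gc.
apply/subspace_continuousP => x Ax.
apply: cvg_trans (gc (f x) (fAB x Ax)).
move=> W H.
have {}H : nbhs (f x) [set y | B y -> W (g y)] := H.
have H' : nbhs x [set u | A u -> B (f u) -> W (g (f u))] := fc x Ax _ H.
rewrite nbhs_simpl; change (nbhs x [set u | A u -> W (g (f u))]).
by apply: filterS H' => u Hu Au; apply: Hu => //; apply: fAB.
Qed.

Lemma within_compT (U V : topologicalType) (f : T -> U) (g : U -> V) :
  {within A, continuous f} -> continuous g -> {within A, continuous (g \o f)}.
Proof.
move=> fc gc; apply: (@within_comp _ _ setT) => //.
exact: continuous_subspaceT.
Qed.

Lemma within_sum (I : Type) (r : seq I) (P : pred I) (f : I -> T -> K) :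
  (forall i, P i -> {within A, continuous (f i)}) ->
  {within A, continuous (fun x => \sum_(i <- r | P i) f i x)}.
Proof.
move=> fc; apply/subspace_continuousP => x Ax.
by apply: (@cvg_bigsum K K^o T I r P _ (within_filter A (nbhs_filter x))) => i /fc /subspace_continuousP; apply.
Qed.

Lemma within_mul (f g : T -> K) : {within A, continuous f} ->
  {within A, continuous g} -> {within A, continuous (fun x => f x * g x)}.
Proof.
move=> /subspace_continuousP fc /subspace_continuousP gc.
by apply/subspace_continuousP => x Ax; apply: cvgM; [apply: fc|apply: gc].
Qed.

Lemma within_add (f g : T -> K) : {within A, continuous f} ->
  {within A, continuous g} -> {within A, continuous (fun x => f x + g x)}.
Proof.
move=> /subspace_continuousP fc /subspace_continuousP gc.
by apply/subspace_continuousP => x Ax; apply: cvgD; [apply: fc|apply: gc].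
Qed.

Lemma within_opp (f : T -> K) : {within A, continuous f} ->
  {within A, continuous (fun x => - f x)}.
Proof.
move=> /subspace_continuousP fc.
by apply/subspace_continuousP => x Ax; apply: cvgN; apply: fc.
Qed.

Lemma within_inv (f : T -> K) : {within A, continuous f} ->
  (forall x, A x -> f x != 0) -> {within A, continuous (fun x => (f x)^-1)}.
Proof.
move=> /subspace_continuousP fc f0.
by apply/subspace_continuousP => x Ax; apply: cvgV; [apply: f0|apply: fc].
Qed.

Lemma within_cst (U : topologicalType) (c : U) : {within A, continuous (fun=> c)}.
Proof. by apply: continuous_subspaceT => x; apply: cvg_cst. Qed.

Lemma within_row n (f : T -> 'rV[K]_n) :
  (forall i, {within A, continuous (fun x => f x 0 i)}) -> {within A, continuous f}.
Proof.
move=> fc; apply/subspace_continuousP => x Ax W.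
move=> [P HP PW].
have H i : \forall y \near within A (nbhs x), P 0 i (f y 0 i).
  by have /subspace_continuousP /(_ x Ax) := fc i; apply; apply: HP.
have H' := @filter_forall _ _ _ _ (within_filter A (nbhs_filter x)) H.
rewrite nbhs_simpl; apply: filterS H' => y Hy.
by apply: PW => i j; rewrite (ord1 i).
Qed.

Lemma within_coord n (f : T -> 'rV[K]_n) i :
  {within A, continuous f} -> {within A, continuous (fun x => f x 0 i)}.
Proof.
move=> fc; apply: (@within_compT _ _ f (fun v : 'rV[K]_n => v 0 i)) => //.
exact: continuous_coord.
Qed.

Lemma within_mulmx n m (f : T -> 'rV[K]_n) (M : 'M[K]_(n, m)) :
  {within A, continuous f} -> {within A, continuous (fun x => f x *m M)}.
Proof.
move=> fc; apply: within_row => i; under eq_fun do rewrite mxE.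
apply: within_sum => j _; apply: within_mul; last exact: within_cst.
exact: within_coord.
Qed.

Lemma within_scale n (c : T -> K) (f : T -> 'rV[K]_n) : {within A, continuous c} ->
  {within A, continuous f} -> {within A, continuous (fun x => c x *: f x)}.
Proof.
move=> cc fc; apply: within_row => i; under eq_fun do rewrite mxE.
by apply: within_mul => //; apply: within_coord.
Qed.

Lemma within_addr n (f g : T -> 'rV[K]_n) : {within A, continuous f} ->
  {within A, continuous g} -> {within A, continuous (fun x => f x + g x)}.
Proof.
move=> fc gc; apply: within_row => i; under eq_fun do rewrite mxE.
by apply: within_add; apply: within_coord.
Qed.

End WithinContinuity.

(** * Order complexes of sets of patterns *)

Section FanSphere.
Variables (R : realType) (p k : nat) (G : 'M[R]_(p, k)).
Variable e1 : 'rV[R]_p.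
Hypothesis e1G : forall i, (e1 *m G) 0 i = 1.

Local Notation pattern := {set {set 'I_k}}.
Local Notation patT_ := [set: {set 'I_k}]%SET.
Local Notation gap := (gap e1G).
Local Notation pat := (pat G).
Local Notation total := (total e1G).
Local Notation rep := (rep e1G).
Local Notation rep_gap := (rep_gap e1G).
Local Notation M := #|{: pattern}|.

Definition weights_of (v : 'rV[R]_M) (Z : pattern) : R := v 0 (enum_rank Z).

Definition coord_space : set 'rV[R]_M :=
  [set v | chain_weights G (weights_of v) /\ \sum_Z weights_of v Z = 1].

Lemma weights_of_continuous Z : continuous (weights_of^~ Z).
Proof. exact: continuous_coord. Qed.

Lemma coord_space_compact : compact coord_space.
Proof.
have clos (f : 'rV[R]_M -> R) (D : set R) :
    continuous f -> closed D -> closed [set v | D (f v)].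
  exact: closed_comp_continuous.
apply: (@subclosed_compact _ _ [set v : 'rV[R]_M | forall i, `[0, 1]%classic (v 0 i)]).
(* Comparability on the support becomes a closed condition when stated as vanishing products over
   incomparable pairs. *)
- have -> : coord_space =
     (\bigcap_Z [set v | 0 <= weights_of v Z]) `&`
     ((\bigcap_(Z in [set Z | ~~ realizable G Z]) [set v | weights_of v Z = 0]) `&`
     ((\bigcap_(ZZ in [set ZZ : pattern * pattern |
          ~ (ZZ.1 \subset ZZ.2 \/ ZZ.2 \subset ZZ.1)])
         [set v | weights_of v ZZ.1 * weights_of v ZZ.2 = 0]) `&`
      [set v | \sum_Z weights_of v Z = 1])).
    apply/seteqP; split=> v /=.
      move=> [[v0 vnr vch] v1]; split; first by move=> Z _; apply: v0.
      split; first by move=> Z; apply: vnr.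
      split=> // -[Z Z'] /= nch; apply/eqP; rewrite mulf_eq0; apply/negPn.
      rewrite negb_or; apply/negP => /andP[Z0 Z0'].
      by apply: nch; apply: vch; rewrite lt0r ?Z0 ?Z0' v0.
    move=> [v0 [vnr [vch v1]]]; split=> //; split.
    - by move=> Z; apply: v0.
    - by move=> Z; apply: vnr.
    move=> Z Z' Z0 Z0'; apply: contrapT => nch.
    have /eqP := vch (Z, Z') nch.
    by rewrite mulf_eq0 /= !gt_eqF.
  apply: closedI; first apply: closed_bigI => Z _.
    by apply: (clos _ [set x | 0 <= x]); [exact: weights_of_continuous|exact: closed_ge].
  apply: closedI; first apply: closed_bigI => Z _.
    by apply: (clos _ [set x | x = 0]); [exact: weights_of_continuous|exact: closed_eq].
  apply: closedI; first apply: closed_bigI => ZZ _.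
    apply: (clos _ [set x | x = 0]); last exact: closed_eq.
    by apply: continuous_mulf; exact: weights_of_continuous.
  apply: (clos _ [set x | x = 1]); last exact: closed_eq.
  by apply: (@continuous_bigsum R R^o) => Z _; exact: weights_of_continuous.
- by apply: (@rV_compact R M (fun=> `[0, 1]%classic)) => i; apply: segment_compact.
move=> v [[v0 _ _] v1] i /=; rewrite in_itv /=.
have := v0 (enum_val i); rewrite /weights_of enum_valK => -> /=.
rewrite -v1 (bigD1 (enum_val i)) //= {1}/weights_of enum_valK lerDl.
by apply: sumr_ge0.
Qed.

(** Multiplied through by [total], so that no division occurs and the equations are closed on all
    heights. *)
Definition coord_graph : set ('rV[R]_k * 'rV[R]_M) :=
  [set x | forall s, gap s x.1 = total x.1 * rep_gap (weights_of x.2) s].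

Lemma total_continuous : continuous total.
Proof.
by apply: (@continuous_bigsum R R^o) => s _; apply: gap_continuous.
Qed.

Lemma coord_graph_closed : closed coord_graph.
Proof.
have -> : coord_graph = \bigcap_s
    [set x | [set 0] (gap s x.1 - total x.1 * rep_gap (weights_of x.2) s)].
  apply/seteqP; split=> x /= H s; first by move=> _ /=; rewrite H subrr.
  by apply/eqP; rewrite -subr_eq0; apply/eqP; apply: (H s).
apply: closed_bigI => s _.
apply: (@closed_comp_continuous _ _
  (fun x => gap s x.1 - total x.1 * rep_gap (weights_of x.2) s)); last exact: closed_eq.
apply: continuous_subr.
  exact: (continuous_compose (@continuous_fst _ _) (@gap_continuous _ _ _ _ _ e1G s)).
apply: continuous_mulf.
  exact: (continuous_compose (@continuous_fst _ _) total_continuous).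
apply: (@continuous_bigsum R R^o) => Z _; apply: continuous_mulr.
exact: (continuous_compose (@continuous_snd _ _) (@weights_of_continuous Z)).
Qed.

Lemma coord_ex w : exists v, pat w != patT_ -> coord_space v /\ coord_graph (w, v).
Proof.
have [wT|wT] := eqVneq (pat w) patT_; first by exists 0.
have [t [tc t1 tg]] := coords_normalized_ex e1G wT.
exists (\row_i t (enum_val i)) => _.
have e : weights_of (\row_i t (enum_val i)) = t.
  by apply/funext => Z; rewrite /weights_of mxE enum_rankK.
by split; [rewrite /coord_space /= e|rewrite /coord_graph /= e].
Qed.

Definition coord w : 'rV[R]_M := projT1 (cid (coord_ex w)).

Lemma coordP w : pat w != patT_ -> coord_space (coord w) /\ coord_graph (w, coord w).
Proof. by rewrite /coord; case: cid. Qed.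

Lemma coord_graph_uniq w v : pat w != patT_ -> coord_space v ->
  coord_graph (w, v) -> v = coord w.
Proof.
move=> wT [vc v1] vg; have [[wc _] wg] := coordP wT.
apply/rowP => i; rewrite -(enum_valK i) -!/(weights_of _ _).
apply: (coords_uniq (e1G := e1G)) => // s.
by apply: (mulfI (lt0r_neq0 (total_gt0 e1G wT))); rewrite -[LHS]vg -[RHS]wg.
Qed.

Lemma coord_continuous_within : {within [set w | pat w != patT_], continuous coord}.
Proof.
apply: (closed_graph_cvg coord_space_compact coord_graph_closed).
  exact: coordP.
by move=> w v /=; apply: coord_graph_uniq.
Qed.

(** Gaps and [total] are scaled by the same factor. Coordinates thus depend only on directions
    modulo affine heights, as a comparison with a sphere requires. *)
Lemma coord_ray w c l : pat w != patT_ -> 0 < c -> coord (c *: w + l *m G) = coord w.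
Proof.
move=> wT c0; have [ws wg] := coordP wT.
apply/esym/coord_graph_uniq => //; first by rewrite pat_shift pat_scale.
move=> s /=; rewrite gap_shift gap_scale ?ltW // [gap s w]wg mulrA; congr (_ * _).
rewrite -total_scale ?ltW //; apply: eq_bigr => s' _.
by rewrite gap_shift.
Qed.

Lemma coord_pat w : pat w != patT_ -> 0 < weights_of (coord w) (pat w) /\
  forall Z, 0 < weights_of (coord w) Z -> pat w \subset Z.
Proof. by move=> wT; have [[wc w1] wg] := coordP wT; apply: coords_min. Qed.

Variable X : {set pattern}.
Hypothesis X_realizable : forall Z, Z \in X -> realizable G Z.

Local Notation N := #|X|.
Local Notation eX := (enum_val : 'I_N -> pattern).
Local Notation realX := (realization (fun Z Z' : pattern => Z \subset Z') (eX) : set 'rV[R]_N).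

Lemma X_proper w : pat w \in X -> pat w != patT_.
Proof. by move=> /X_realizable /andP[]. Qed.

Definition ext_weights (t : 'rV[R]_N) (Z : pattern) : R :=
  \sum_(i | eX i == Z) t 0 i.

Lemma ext_weights_enum t i : ext_weights t (eX i) = t 0 i.
Proof.
rewrite /ext_weights (eq_bigl (pred1 i)) ?big_pred1_eq // => j.
by rewrite /= (inj_eq enum_val_inj).
Qed.

Lemma ext_weights_off t Z : Z \notin X -> ext_weights t Z = 0.
Proof.
move=> ZX; rewrite /ext_weights big1 // => i /eqP e.
by move: ZX; rewrite -e enum_valP.
Qed.

Lemma sum_over_X (V : zmodType) (f : pattern -> V) : (forall Z, Z \notin X -> f Z = 0) ->
  \sum_Z f Z = \sum_i f (eX i).
Proof.
move=> f0; rewrite (bigID (mem X)) /= [X in _ + X]big1 ?addr0; last first.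
  by move=> Z; apply: f0.
by rewrite -big_enum_val.
Qed.

Lemma ext_weights_chain t : realX t -> chain_weights G (ext_weights t).
Proof.
move=> [t0 [t1 tch]].
have off Z : 0 < ext_weights t Z -> exists i, eX i = Z.
  move=> pos; have ZX : Z \in X.
    by apply: contraTT pos => /(ext_weights_off t) ->; rewrite ltxx.
  by exists (enum_rank_in ZX Z); rewrite enum_rankK_in.
split=> [Z|Z Zn|Z Z' ZP ZP'].
- by apply: sumr_ge0.
- by apply: ext_weights_off; apply: contra Zn; apply: X_realizable.
- have [i iZ] := off _ ZP; have [j jZ] := off _ ZP'.
  move: ZP ZP'; rewrite -iZ -jZ !ext_weights_enum; exact: tch.
Qed.

Lemma ext_weights_sum t : realX t -> \sum_Z ext_weights t Z = 1.
Proof.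
move=> [_ [t1 _]]; rewrite sum_over_X => [|Z]; last exact: ext_weights_off.
by rewrite -[RHS]t1; apply: eq_bigr => i _; rewrite ext_weights_enum.
Qed.

Definition height_of (t : 'rV[R]_N) : 'rV[R]_k := \sum_i t 0 i *: rep (eX i).

Lemma height_ofE t : height_of t = Phi e1G (ext_weights t).
Proof.
rewrite /height_of /Phi sum_over_X; last first.
  by move=> Z /(ext_weights_off t) ->; rewrite scale0r.
apply: eq_bigr => i _.
by rewrite ext_weights_enum.
Qed.

Lemma chain_weights_pos t : chain_weights G t -> \sum_Z t Z = 1 -> exists Z, 0 < t Z.
Proof.
move=> [t0 _ _] t1; apply/not_existsP => none.
move: (oner_neq0 R); rewrite -t1 big1 ?eqxx // => Z _.
by apply/eqP/negPn/negP => H; apply: (none Z); rewrite lt0r H t0.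
Qed.

Lemma height_of_pat t : realX t -> pat (height_of t) \in X.
Proof.
move=> tX; have tc := ext_weights_chain tX.
have [Z1 Z1P] := chain_weights_pos tc (ext_weights_sum tX).
have [Z0 Z0P min] := chain_min tc Z1P.
rewrite height_ofE (pat_Phi e1G tc Z0P min).
by apply: contraTT Z0P => /(ext_weights_off t) ->; rewrite ltxx.
Qed.

Definition massX w : R := \sum_i weights_of (coord w) (eX i).

Definition baryX w : 'rV[R]_N := \row_i ((massX w)^-1 * weights_of (coord w) (eX i)).

Lemma massX_gt0 w : pat w \in X -> 0 < massX w.
Proof.
move=> wX; have wT := X_proper wX; have [[[w0 _ _] _] _] := coordP wT.
have [wP _] := coord_pat wT.
rewrite /massX (bigD1 (enum_rank_in wX (pat w))) //= enum_rankK_in //.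
by rewrite ltr_wpDr // sumr_ge0.
Qed.

Lemma baryX_real w : pat w \in X -> realX (baryX w).
Proof.
move=> wX; have m0 := massX_gt0 wX; have [[[w0 _ wch] _] _] := coordP (X_proper wX).
split; first by move=> i; rewrite mxE mulr_ge0 // invr_ge0 ltW.
split.
  by under eq_bigr do rewrite mxE; rewrite -mulr_sumr mulVf // gt_eqF.
by move=> i j; rewrite !mxE !pmulr_rgt0 ?invr_gt0 //; apply: wch.
Qed.

Lemma baryX_continuous : {within [set w | pat w \in X], continuous baryX}.
Proof.
have cc : {within [set w | pat w \in X], continuous coord}.
  apply: continuous_subspaceW coord_continuous_within.
  by move=> w; apply: X_proper.
have cw Z : {within [set w | pat w \in X], continuous (fun w => weights_of (coord w) Z)}.
  exact: within_coord.
apply: within_row => i.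
rewrite (_ : (fun w => _) = fun w => (massX w)^-1 * weights_of (coord w) (eX i)); last first.
  by apply/funext => w; rewrite mxE.
apply: within_mul; last exact: cw.
apply: within_inv; first by apply: within_sum => j _; apply: cw.
by move=> w /massX_gt0 /lt0r_neq0.
Qed.

Lemma baryX_ray w c l : pat w \in X -> 0 < c -> baryX (c *: w + l *m G) = baryX w.
Proof. by move=> wX c0; rewrite /baryX /massX coord_ray // X_proper. Qed.

(** Uniqueness of coordinates: the weights of [t] already solve the equations for [height_of t], and
    they have no mass outside [X] to lose. *)
Lemma baryX_height t : realX t -> baryX (height_of t) = t.
Proof.
move=> tX; have tc := ext_weights_chain tX.
have hX := height_of_pat tX; have hT := X_proper hX.
have tot : total (height_of t) = 1.
  rewrite /total -(ext_weights_sum tX) -(sum_rep_gap e1G tc); apply: eq_bigr => s _.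
  by rewrite height_ofE gap_Phi.
pose v : 'rV[R]_M := \row_i ext_weights t (enum_val i).
have ve : weights_of v = ext_weights t.
  by apply/funext => Z; rewrite /weights_of mxE enum_rankK.
have vE : v = coord (height_of t).
  apply: coord_graph_uniq => //.
    by split; rewrite ve //; apply: ext_weights_sum.
  by move=> s /=; rewrite ve tot mul1r height_ofE gap_Phi.
have [_ [t1 _]] := tX.
have mE : massX (height_of t) = 1.
  rewrite /massX -vE ve -[RHS]t1; apply: eq_bigr => i _.
  by rewrite ext_weights_enum.
apply/rowP => i; rewrite mxE mE invr1 mul1r -vE ve; exact: ext_weights_enum.
Qed.

(** The smallest pattern of the support is [pat w], which lies in [X] and survives the truncation;
    it alone fixes the pattern of the rebuilt height. *)
Lemma height_bary_pat w : pat w \in X ->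
  pat (height_of (baryX w)) = pat w.
Proof.
move=> wX; have tX := baryX_real wX; have tc := ext_weights_chain tX.
have [cP cmin] := coord_pat (X_proper wX); have m0 := massX_gt0 wX.
rewrite height_ofE; apply: (pat_Phi e1G tc).
  rewrite -[pat w](enum_rankK_in wX wX) ext_weights_enum mxE enum_rankK_in //.
  by rewrite mulr_gt0 // invr_gt0.
move=> Z ZP.
have ZX : Z \in X.
  by apply: contraTT ZP => /(ext_weights_off _) ->; rewrite ltxx.
apply: cmin; move: ZP; rewrite -[Z](enum_rankK_in ZX ZX) ext_weights_enum mxE.
by rewrite pmulr_rgt0 // invr_gt0.
Qed.

Definition normalize d (x : 'rV[R]_d) : 'rV[R]_d :=
  (Num.sqrt (\sum_i x 0 i ^+ 2))^-1 *: x.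

Lemma sum_sqr_gt0 d (x : 'rV[R]_d) : x != 0 -> 0 < \sum_i x 0 i ^+ 2.
Proof.
move=> x0; rewrite lt0r sumr_ge0 ?andbT => [|i _]; last exact: sqr_ge0.
apply: contra x0; rewrite psumr_eq0 => [/allP H|i _]; last exact: sqr_ge0.
apply/eqP/rowP => i; rewrite mxE; apply/eqP.
by have := H i (mem_index_enum _); rewrite /= sqrf_eq0.
Qed.

Lemma normalize_sphere d (x : 'rV[R]_d) : x != 0 -> usphere (normalize x).
Proof.
move=> /sum_sqr_gt0 x0; rewrite /usphere /=.
under eq_bigr do rewrite mxE exprMn exprVn sqr_sqrtr ?ltW //.
by rewrite -mulr_sumr mulVf // gt_eqF.
Qed.

Lemma normalize_id d (x : 'rV[R]_d) : usphere x -> normalize x = x.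
Proof. by rewrite /usphere /normalize /= => ->; rewrite sqrtr1 invr1 scale1r. Qed.

Lemma usphere_neq0 d (x : 'rV[R]_d) : usphere x -> x != 0.
Proof.
rewrite /usphere /=; apply: contra_eqN => /eqP ->.
rewrite big1 => [|i _]; last by rewrite mxE expr0n.
by rewrite eq_sym oner_eq0.
Qed.

Lemma within_normalize (T : topologicalType) (A : set T) d (f : T -> 'rV[R]_d) :
  {within A, continuous f} -> (forall x, A x -> f x != 0) ->
  {within A, continuous (fun x => normalize (f x))}.
Proof.
move=> fc f0; apply: within_scale => //; apply: within_inv; last first.
  by move=> x /f0 /sum_sqr_gt0; rewrite -sqrtr_gt0 => /lt0r_neq0.
apply: (@within_compT T A R^o R^o (fun x => \sum_i f x 0 i ^+ 2) (@Num.sqrt R)); last first.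
  exact: sqrt_continuous.
by apply: within_sum => i _; apply: within_mul; apply: within_coord.
Qed.

(** Open cones are convex: off the pattern both gaps are positive, and they combine linearly. *)
Lemma pat_mix w w' a b : pat w = pat w' -> 0 <= a -> 0 <= b -> 0 < a + b ->
  pat (a *: w + b *: w') = pat w.
Proof.
move=> e a0 b0 ab; apply/setP => s; rewrite -(gap_eq0 e1G).
rewrite (gap_lin e1G s (subxx (pat w))) ?e //.
have [sw|sw] := boolP (s \in pat w').
  have /eqP -> : gap s w' == 0 by rewrite gap_eq0.
  have /eqP -> : gap s w == 0 by rewrite gap_eq0 e.
  by rewrite !mulr0 addr0 eqxx.
have g' : 0 < gap s w' by rewrite lt0r gap_ge0 gap_eq0 sw.
have g : 0 < gap s w by rewrite lt0r gap_ge0 gap_eq0 e sw.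
apply/negbTE; rewrite gt_eqF //.
have [a1|a1] := eqVneq a 0; first by rewrite a1 mul0r add0r mulr_gt0 //; lra.
by rewrite ltr_pwDl ?mulr_gt0 ?mulr_ge0 ?(ltW g') // lt0r a1.
Qed.

Lemma within_height_of (T : topologicalType) (A : set T) (f : T -> 'rV[R]_N) :
  {within A, continuous f} -> {within A, continuous (fun x => height_of (f x))}.
Proof.
move=> fc; rewrite (_ : (fun x => _) =
    fun x => f x *m (\matrix_i rep (eX i) : 'M_(N, k))); first exact: within_mulmx.
apply/funext => x; rewrite mulmx_sum_row; apply: eq_bigr => i _.
by rewrite rowK.
Qed.

Lemma unit_intP (s : R) : unit_int s -> 0 <= s /\ 0 <= 1 - s.
Proof. by rewrite /unit_int /= subr_ge0 => /andP[]. Qed.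

(* The sphere sits in the space of heights as [u *m B], and [fun w => r w *m C]
   retracts the heights with pattern in [X] onto it along segments that keep
   the pattern in [X]; [baryX] and [height_of] compare these heights with the
   order complex of [X]. *)
Lemma fan_sphere d (B : 'M[R]_(d, k)) (C : 'M[R]_(k, d)) (r : 'rV[R]_k -> 'rV[R]_k) :
  continuous r -> B *m C = 1%:M -> G *m C = 0 ->
  (forall w, (r w - r w *m C *m B <= G)%MS) ->
  (forall w s, pat w \in X -> unit_int s -> pat ((1 - s) *: r w + s *: w) \in X) ->
  (forall u, r (u *m B) = u *m B) -> (forall u, u != 0 -> pat (u *m B) \in X) ->
  homotopy_equiv R realX (@usphere R d).
Proof.
move=> rc BC GC rG rX rB BX.
have rX0 w : pat w \in X -> pat (r w) \in X.
  move=> wX; have := @rX w 0 wX; rewrite subr0 scale1r scale0r addr0; apply.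
  by rewrite /unit_int /= lexx ler01.
have rC0 w : pat w \in X -> r w *m C != 0.
  move=> /rX0 wX; apply/eqP => e; have := rG w; rewrite e mul0mx subr0 => sub.
  have := X_proper wX; rewrite (_ : pat (r w) = patT_) ?eqxx //.
  exact/patT.
pose f t := normalize (r (height_of t) *m C).
pose g u := baryX (u *m B).
(* Passing through the sphere changes the height by a positive factor and a summand in the row space
   of [G], both invisible to [baryX]. *)
have gf t : realX t -> g (f t) = baryX (r (height_of t)).
  move=> tX; have hX := height_of_pat tX; rewrite /g /f /normalize.
  set c := _^-1; have c0 : 0 < c.
    by rewrite invr_gt0 sqrtr_gt0 sum_sqr_gt0 // rC0.
  have /submxP[l lE] := rG (height_of t).
  have -> : c *: (r (height_of t) *m C) *m B
      = c *: r (height_of t) + (- (c *: l)) *m G.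
    rewrite -scalemxAl -{2}[r (height_of t)](subrK (r (height_of t) *m C *m B)) lE.
    by rewrite scalerDr mulNmx -scalemxAl addrC addrA addNr add0r.
  by rewrite baryX_ray // rX0.
exists f, g; split; first split.
- apply: within_normalize; last by move=> t /height_of_pat /rC0.
  apply: within_mulmx.
  apply: (@within_compT _ _ _ _ height_of r) => //.
  by apply: within_height_of; apply: continuous_subspaceT => x; apply: cvg_id.
- by move=> _ [t tX <-]; apply/normalize_sphere/rC0/height_of_pat.
- change {within @usphere R d, continuous (baryX \o (fun u : 'rV[R]_d => u *m B))}.
  apply: (@within_comp _ _ _ _ [set w | pat w \in X]).
  + by apply: within_mulmx; apply: continuous_subspaceT => x; apply: cvg_id.
  + by move=> u /usphere_neq0 /BX.
  + exact: baryX_continuous.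
- by move=> _ [u uS <-]; apply/baryX_real/BX/usphere_neq0.
split.
(* On the order complex, the retracted height slides back to [height_of t] without leaving the
   patterns of [X]. *)
- pose mix (x : R * 'rV[R]_N) := (1 - x.1) *: r (height_of x.2) + x.1 *: height_of x.2.
  have mixX x : (unit_int (R := R) `*` realX) x -> pat (mix x) \in X.
    by move=> [x1 x2]; apply: rX => //; apply: height_of_pat.
  exists (baryX \o mix); split; last split.
  + apply: (@within_comp _ _ _ _ [set w | pat w \in X]) => //.
      have hc : {within unit_int (R := R) `*` realX, continuous (fun x => height_of x.2)}.
        by apply: within_height_of; exact/continuous_subspaceT/continuous_snd.
      apply: within_addr; apply: within_scale => //.
      * apply: within_add; first exact: within_cst.
        by apply: within_opp; exact/continuous_subspaceT/continuous_fst.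
      * by apply: (@within_compT _ _ _ _ (fun x => height_of x.2) r).
      * exact/continuous_subspaceT/continuous_fst.
    exact: baryX_continuous.
  + by move=> s t s01 tX; apply/baryX_real/mixX.
  + move=> t tX; rewrite /= /mix /= subr0 subrr scale0r scale1r addr0 scale0r scale1r add0r.
    by rewrite gf // baryX_height.
(* On the sphere, [u *m B] and its rebuilt height share an open cone, so the segment between them
   keeps its pattern and can be retracted and normalized. *)
pose mix (x : R * 'rV[R]_d) :=
  (1 - x.1) *: height_of (baryX (x.2 *m B)) + x.1 *: (x.2 *m B).
have mixX x : (unit_int (R := R) `*` @usphere R d) x -> pat (mix x) \in X.
  move=> [/unit_intP[s0 s1] x2]; have uX := BX _ (usphere_neq0 x2).
  rewrite pat_mix ?height_bary_pat //; lra.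
exists (fun x => normalize (r (mix x) *m C)); split; last split.
- apply: within_normalize; last by move=> x /mixX /rC0.
  apply: within_mulmx; apply: (@within_compT _ _ _ _ mix r) => //.
  have sndB : {within unit_int (R := R) `*` @usphere R d, continuous (fun x => x.2 *m B)}.
    by apply: within_mulmx; exact/continuous_subspaceT/continuous_snd.
  have f1 : {within unit_int (R := R) `*` @usphere R d, continuous fst}.
    exact/continuous_subspaceT/continuous_fst.
  apply: within_addr; apply: within_scale => //.
    apply: within_add; first exact: within_cst.
    exact: within_opp.
  apply: within_height_of.
  change {within unit_int (R := R) `*` @usphere R d,
    continuous (baryX \o (fun x : R * 'rV[R]_d => x.2 *m B))}.
  apply: (@within_comp _ _ _ _ [set w | pat w \in X]) => //.
    by move=> [s u] [_ /usphere_neq0 /BX].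
  exact: baryX_continuous.
- by move=> s u s01 uS; apply/normalize_sphere/rC0/mixX.
move=> u uS; rewrite /= /mix /= subr0 subrr !scale0r !scale1r addr0 add0r; split=> //.
by rewrite rB -mulmxA BC mulmx1 normalize_id.
Qed.

End FanSphere.

(** * Exchange of optimal solutions and perturbation of contacts *)

Section SupportTransfer.
Variables (R : realType) (p k : nat) (G : 'M[R]_(p, k)).
Local Notation ev := (ev G).
Local Notation below := (below G).
Local Notation contact := (contact G).
Local Notation same_moment := (same_moment G).

(** Optimal values depend only on the moments, so an optimal measure is complementary to every
    affine function that is optimal for the same moments. *)
Lemma support_transfer mu nu l1 l2 w :
  (forall i, 0 <= mu i) -> (forall i, 0 <= nu i) -> same_moment mu nu ->
  below l1 w -> below l2 w ->
  (forall i, i \notin contact l1 w -> mu i = 0) ->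
  (forall i, i \notin contact l2 w -> nu i = 0) ->
  forall i, 0 < mu i -> i \in contact l2 w.
Proof.
move=> mu0 nu0 mm l1w l2w s1 s2; apply: (tight_support mu0 l2w).
rewrite (optimal_value_unique mu0 nu0 l1w l2w s1 s2 mm).
by rewrite (complementary_slackness s2) mm.
Qed.

Lemma small_eps (I : finType) (P : pred I) (s b : I -> R) :
  (forall i, P i -> 0 < s i) ->
  exists2 eps, 0 < eps & forall i, P i -> eps * b i < s i.
Proof.
move=> s0.
have [eps e0 H] : exists2 eps, 0 < eps & forall i, i \in index_enum I -> P i -> eps * b i < s i.
  elim: (index_enum I) => [|j r [eps e0 IH]]; first by exists 1.
  have [Pj|nPj] := boolP (P j); last first.
    exists eps => // i; rewrite inE => /orP[/eqP ->|]; last exact: IH.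
    by rewrite (negPf nPj).
  pose e' := s j / (1 + `|b j|).
  have d0 : 0 < 1 + `|b j| by rewrite ltr_wpDr.
  have e'0 : 0 < e' by rewrite divr_gt0 // s0.
  have mon x i : 0 < x -> 0 < s i -> x * b i < s i ->
      forall y, 0 < y -> y <= x -> y * b i < s i.
    move=> x0 si H y y0 yx; have [bi|bi] := ltP 0 (b i).
      by apply: le_lt_trans H; rewrite ler_pM2r.
    by apply: le_lt_trans si; rewrite pmulr_rle0.
  have m0 : 0 < Num.min eps e' by rewrite lt_min e0.
  exists (Num.min eps e') => // i; rewrite inE => /orP[/eqP ->|ir] Pi.
    apply: (mon e') => //; [exact: s0| |by rewrite ge_min lexx orbT].
    rewrite /e' mulrAC ltr_pdivrMr // ltr_pM2l ?s0 //.
    by apply: le_lt_trans (ler_norm _) _; rewrite ltrDr.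
  by apply: (mon eps) => //; [exact: s0|exact: IH|rewrite ge_min lexx].
by exists eps => // i; apply: H; apply: mem_index_enum.
Qed.

(** Tilting [l'] down by a small multiple of [l] releases the tight labels where [l] is positive and
    keeps those where it vanishes; the strict slacks elsewhere survive. Geometrically, a face of a
    cell is a cell. *)
Lemma contact_perturb l' l w : below l' w ->
  (forall i, i \in contact l' w -> 0 <= ev l i) ->
  exists2 l'', below l'' w & contact l'' w = [set i in contact l' w | ev l i == 0].
Proof.
move=> lw' l0.
have [i|eps e0 He] := @small_eps _ (fun i => i \notin contact l' w)
    (fun i => w 0 i - ev l' i) (fun i => - ev l i).
  by rewrite /= inE subr_gt0 lt_neqAle lw' andbT.
have pos i : i \notin contact l' w -> ev (l' - eps *: l) i < w 0 i.
  by move=> /He; rewrite evB evZ; lra.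
have tight i : i \in contact l' w -> ev (l' - eps *: l) i = w 0 i - eps * ev l i.
  by rewrite inE evB evZ => /eqP ->.
exists (l' - eps *: l).
  move=> i; have [ic|/pos/ltW//] := boolP (i \in contact l' w).
  by rewrite tight // gerBl mulr_ge0 ?(ltW e0) ?l0.
apply/setP => i; rewrite [RHS]finset.in_set.
have [ic|ic] := boolP (i \in contact l' w) => /=.
  rewrite [LHS]finset.in_set tight // -subr_eq0 addrC addKr oppr_eq0.
  by rewrite mulf_eq0 gt_eqF.
by rewrite [LHS]finset.in_set lt_eqF ?pos.
Qed.

End SupportTransfer.

(** * Balanced patterns *)

Section Dependency.
Variables (R : realType) (p k : nat) (G : 'M[R]_(p, k)).
Variable e1 : 'rV[R]_p.
Hypothesis e1G : forall i, (e1 *m G) 0 i = 1.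
Local Notation ev := (ev G).
Local Notation below := (below G).
Local Notation contact := (contact G).
Local Notation same_moment := (same_moment G).
Local Notation pat := (pat G).
Local Notation patT_ := [set: {set 'I_k}]%SET.

Implicit Types (lam : 'I_k -> R) (w : 'rV[R]_k).

Definition dependency lam := forall l, \sum_i lam i * ev l i = 0.
Definition pos_part lam : {set 'I_k} := [set i | 0 < lam i].
Definition pairing lam w : R := \sum_i lam i * w 0 i.

Lemma dependencyN lam : dependency lam -> dependency (fun i => - lam i).
Proof.
by move=> dl l; under eq_bigr do rewrite mulNr; rewrite sumrN dl oppr0.
Qed.

Lemma pairingN lam w : pairing (fun i => - lam i) w = - pairing lam w.
Proof. by rewrite /pairing -sumrN; apply: eq_bigr => i _; rewrite mulNr. Qed.

Lemma pos_partNN lam : pos_part (fun i => - - lam i) = pos_part lam.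
Proof. by apply/setP => i; rewrite !inE opprK. Qed.

(* When [lam] is the dependency of the vertices of [P], these are the heights all
   of whose contacts are vertex sets of faces of [P]. *)
Definition balanced lam (Z : {set {set 'I_k}}) :=
  (pos_part lam \in Z) == (pos_part (fun i => - lam i) \in Z).

Lemma balancedN lam Z : balanced (fun i => - lam i) Z = balanced lam Z.
Proof. by rewrite /balanced pos_partNN eq_sym. Qed.

(** Radon's partition, unnormalized: the two parts are measures representing one common point. *)
Lemma radon_moment lam : dependency lam ->
  same_moment (fun i => Num.max (lam i) 0) (fun i => Num.max (- lam i) 0).
Proof.
move=> dl l; apply/eqP; rewrite -subr_eq0 -sumrB; apply/eqP.
rewrite -[RHS](dl l); apply: eq_bigr => i _; rewrite -mulrBl; congr (_ * _).
by case: (leP (lam i) 0) => H; case: (leP (- lam i) 0) => H'; lra.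
Qed.

(** Balance only provides some function tight on the negative part; both Radon measures are optimal
    with the same moments, so [support_transfer] makes the given [l] tight there too. *)
Lemma balanced_contact lam w l : dependency lam -> balanced lam (pat w) ->
  below l w -> pos_part lam \subset contact l w ->
  pos_part (fun i => - lam i) \subset contact l w.
Proof.
move=> dl bal lw sub.
have : pos_part (fun i => - lam i) \in pat w.
  by rewrite -(eqP bal); apply: mem_pat_contact lw sub.
move=> /patP[l' [lw' sub']].
have mm := radon_moment (dependencyN dl).
apply/fintype.subsetP => i; rewrite inE => li.
apply: (@support_transfer _ _ _ G (fun i => Num.max (- lam i) 0)
   (fun i => Num.max (- - lam i) 0) l' l w) => //.
- by move=> j; rewrite le_max lexx orbT.
- by move=> j; rewrite le_max lexx orbT.
- move=> j jl; apply: max_r; rewrite leNgt; apply: contra jl => H.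
  by apply: (fintype.subsetP sub'); rewrite inE.
- move=> j jl; apply: max_r; rewrite opprK leNgt; apply: contra jl => H.
  by apply: (fintype.subsetP sub); rewrite inE.
- by rewrite lt_max li.
Qed.

Lemma pairing_slack lam w l : dependency lam ->
  pairing lam w = \sum_i lam i * (w 0 i - ev l i).
Proof.
move=> dl; under [RHS]eq_bigr do rewrite mulrBr.
by rewrite sumrB dl subr0.
Qed.

(** With the positive part tight, the weighted slacks are all nonpositive while their sum is
    nonnegative, so they vanish. *)
Lemma pairing_tight lam w l : dependency lam -> 0 <= pairing lam w -> below l w ->
  pos_part lam \subset contact l w -> pos_part (fun i => - lam i) \subset contact l w.
Proof.
move=> dl; rewrite (pairing_slack w l dl) => pos lw sub.
have neg i : lam i * (w 0 i - ev l i) <= 0.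
  have [li|li] := ltP 0 (lam i); last by rewrite mulr_le0_ge0 // subr_ge0.
  have : i \in contact l w by apply: (fintype.subsetP sub); rewrite inE.
  by rewrite inE => /eqP ->; rewrite subrr mulr0.
have : \sum_i - (lam i * (w 0 i - ev l i)) = 0.
  apply/eqP; rewrite eq_le; apply/andP; split; first by rewrite sumrN oppr_le0.
  by apply: sumr_ge0 => i _; rewrite oppr_ge0.
move/eqP; rewrite psumr_eq0 => [/allP H|i _]; last by rewrite oppr_ge0.
apply/fintype.subsetP => i; rewrite inE oppr_gt0 => li.
have := H i (mem_index_enum _); rewrite /= oppr_eq0 mulf_eq0 lt_eqF //= subr_eq0.
by rewrite inE eq_sym.
Qed.

Lemma pairing_pat lam w : dependency lam -> 0 <= pairing lam w ->
  pos_part lam \in pat w -> pos_part (fun i => - lam i) \in pat w.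
Proof.
move=> dl pos /patP[l [lw sub]]; apply: (mem_pat_contact lw).
exact: (pairing_tight dl pos lw sub).
Qed.

Lemma balanced0 lam w : dependency lam -> pairing lam w = 0 -> balanced lam (pat w).
Proof.
move=> dl p0; apply/eqP; apply/idP/idP; first by apply: pairing_pat; rewrite ?p0.
have := @pairing_pat _ w (dependencyN dl); rewrite pairingN p0 oppr0 pos_partNN.
by apply.
Qed.

Definition pos_mass lam : R := \sum_(i in pos_part lam) lam i.

Definition lower lam w (c : R) : 'rV[R]_k :=
  \row_i (w 0 i - c * (i \in pos_part lam)%:R).

Lemma pairing_lower lam w c : pairing lam (lower lam w c) = pairing lam w - c * pos_mass lam.
Proof.
rewrite /pairing /pos_mass mulr_sumr [X in _ = _ - X]big_mkcond /= -sumrB.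
apply: eq_bigr => i _; rewrite mxE; case: ifP => _; rewrite ?mulr1n ?mulr0n; ring.
Qed.

(** A positive pairing excludes tightness of the positive part, hence by balance that of the
    negative part. Lowering shrinks the set of functions below and leaves the heights on the
    negative part alone, so that part stays outside the pattern; the nonnegative new pairing then
    keeps the positive part out as well. *)
Lemma balanced_lower lam w c : dependency lam -> balanced lam (pat w) ->
  0 < pairing lam w -> 0 <= c -> 0 <= pairing lam (lower lam w c) ->
  balanced lam (pat (lower lam w c)) /\ pat (lower lam w c) != patT_.
Proof.
move=> dl bal pos c0 pos'.
have n1 : pos_part (fun i => - lam i) \notin pat w.
  rewrite -(eqP bal); apply/negP => /patP[l [lw sub]].
  move: pos; rewrite (pairing_slack w l dl) ltNge => /negP; apply.
  apply: sumr_le0 => i _; have [li|li] := ltP 0 (lam i).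
    have : i \in contact l w by apply: (fintype.subsetP sub); rewrite inE.
    by rewrite inE => /eqP ->; rewrite subrr mulr0.
  by rewrite mulr_le0_ge0 // subr_ge0.
have n2 : pos_part (fun i => - lam i) \notin pat (lower lam w c).
  apply: contra n1 => /patP[l [lw sub]].
  apply: (@mem_pat_contact _ _ _ _ _ _ l).
    by move=> i; apply: (le_trans (lw i)); rewrite mxE gerBl mulr_ge0 // ler0n.
  apply/fintype.subsetP => i ip; have := fintype.subsetP sub i ip.
  rewrite !inE mxE inE; move: ip; rewrite inE oppr_gt0 => li.
  by rewrite (lt_gtF li) mulr0 subr0.
split; last by apply: contra n2 => /eqP ->; rewrite finset.in_setT.
rewrite /balanced (negPf n2); apply/eqP/negbTE; apply: contra n2.
exact: pairing_pat.
Qed.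

(* The slack of a contact can be changed, without changing its zero set, into
   a height vector annihilated by the dependency. *)
Lemma slack_lift_pos lam w l : dependency lam -> below l w ->
  (pos_part (fun i => - lam i) \subset contact l w -> pos_part lam \subset contact l w) ->
  0 <= pairing lam w ->
  exists2 y : 'rV[R]_k, pairing lam y = 0 &
    forall i, 0 <= y 0 i /\ (y 0 i == 0) = (i \in contact l w).
Proof.
move=> dl lw imp; rewrite le_eqVlt => /predU1P[p0|pos].
  exists (w - l *m G).
    by rewrite [RHS]p0 (pairing_slack w l dl); apply: eq_bigr => i _; rewrite ev_row !mxE.
  move=> i; rewrite !inE ev_row !mxE subr_ge0 lw; split=> //.
  by rewrite subr_eq0 eq_sym.
(* Were all negative labels tight, the positive ones would be too, and the pairing could not be
   positive. *)
have [j jn jc] : exists2 j, lam j < 0 & j \notin contact l w.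
  have /negP : ~ pos_part (fun i => - lam i) \subset contact l w.
    move=> /imp sub; move: pos; rewrite (pairing_slack w l dl) ltNge => /negP; apply.
    apply: sumr_le0 => i _; have [li|li] := ltP 0 (lam i).
      have : i \in contact l w by apply: (fintype.subsetP sub); rewrite inE.
      by rewrite inE => /eqP ->; rewrite subrr mulr0.
    by rewrite mulr_le0_ge0 // subr_ge0.
  by move=> /fintype.subsetPn[j]; rewrite inE oppr_gt0 => *; exists j.
(* The extra slack at [j] that cancels the pairing; [j] is not tight, so the zero set is
   unchanged. *)
pose c := - (pairing lam w / lam j).
have c0 : 0 < c by rewrite oppr_gt0 pmulr_rlt0 // invr_lt0.
exists (\row_i (w 0 i - ev l i + c * (i == j)%:R)).
  rewrite /pairing; under eq_bigr do rewrite mxE mulrDr.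
  rewrite big_split /= -(pairing_slack w l dl) (bigD1 j) //= eqxx mulr1 big1 ?addr0.
    by rewrite /c mulrN mulrC divfK ?subrr // lt_eqF.
  by move=> i /negPf ->; rewrite !mulr0.
move=> i; rewrite mxE; have [->|ij] := eqVneq i j.
  have sj : 0 < w 0 j - ev l j.
    by rewrite subr_gt0 lt_neqAle lw andbT; move: jc; rewrite inE.
  rewrite mulr1 (negPf jc); split; last by rewrite gt_eqF // addr_gt0.
  by rewrite ltW // addr_gt0.
by rewrite mulr0 addr0 subr_ge0 lw subr_eq0 inE eq_sym.
Qed.

Lemma slack_lift lam w l : dependency lam -> balanced lam (pat w) -> below l w ->
  exists2 y : 'rV[R]_k, pairing lam y = 0 &
    forall i, 0 <= y 0 i /\ (y 0 i == 0) = (i \in contact l w).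
Proof.
move=> dl bal lw; have [pos|neg] := leP 0 (pairing lam w).
  apply: slack_lift_pos => //.
  have := @balanced_contact (fun i => - lam i) w l (dependencyN dl).
  by rewrite balancedN pos_partNN; apply.
have [||y py Hy] := @slack_lift_pos (fun i => - lam i) w l (dependencyN dl) lw.
- by rewrite pos_partNN; apply: balanced_contact.
- by rewrite pairingN oppr_ge0 ltW.
by exists y => //; apply/eqP; rewrite -oppr_eq0 -pairingN py.
Qed.

End Dependency.

(** [B] is a basis of a complement of [G] in [H], and [C] is the block of a right inverse of the
    combined basis that reads off the coordinates along [B]. *)
Lemma complement_coords (F : fieldType) (p q k d : nat) (G : 'M[F]_(p, k)) (H : 'M[F]_(q, k)) :
  (G <= H)%MS -> \rank H = (d + \rank G)%N ->
  exists (B : 'M[F]_(d, k)) (C : 'M[F]_(k, d)),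
    [/\ (B <= H)%MS, B *m C = 1%:M, G *m C = 0 &
        forall w : 'rV_k, (w <= H)%MS -> (w - w *m C *m B <= G)%MS].
Proof.
move=> GH rk.
have eD : \rank (H :\: G)%MS = d.
  have := mxrank_cap_compl H G; rewrite (capmx_idPr GH) rk addnC => /eqP.
  by rewrite eqn_add2r => /eqP.
have sumD : (H :\: G + G :=: H)%MS.
  apply: eqmx_trans (addsmx_diff_cap_eq H G).
  by apply: adds_eqmx => //; apply: eqmx_sym; apply/capmx_idPr.
subst d.
set b := row_base (H :\: G)%MS; set g := row_base G.
have free : row_free (col_mx b g).
  rewrite /row_free -addsmxE mxrank_disjoint_sum; first by rewrite !eq_row_base.
  apply/eqP; rewrite -submx0 -(capmx_diff H G).
  by rewrite capmxS ?eq_row_base.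
have := mulmxVp free; set C' := pinvmx _ => CV.
have [bC gC] : b *m lsubmx C' = 1%:M /\ g *m lsubmx C' = 0.
  move: CV; rewrite -{1}[C']hsubmxK mul_col_row scalar_mx_block.
  by move=> /eq_block_mx[-> _ -> _].
move: (lsubmx C') bC gC => C bC gC.
have GC : G *m C = 0.
  have /submxP[M e] : (G <= g)%MS by rewrite eq_row_base.
  by move: (congr1 (mulmx^~ C) e) => /= ->; rewrite -mulmxA gC mulmx0.
exists b, C; split => // [|w].
  by rewrite eq_row_base diffmxSl.
rewrite -sumD => /sub_addsmxP[[u v] /= ->].
have /submxP[M bM] : (u *m (H :\: G)%MS <= b)%MS.
  by apply: (submx_trans (submxMl _ _)); rewrite eq_row_base.
rewrite bM mulmxDl -(mulmxA M) bC mulmx1 -(mulmxA v) GC mulmx0 addr0.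
by rewrite addrC addKr submxMl.
Qed.

(** * The retraction *)

Section RadonSphere.
Variables (R : realType) (p q k : nat) (G : 'M[R]_(p, k)) (H : 'M[R]_(q, k)).
Variable e1 : 'rV[R]_p.
Hypothesis e1G : forall i, (e1 *m G) 0 i = 1.
Hypothesis GH : (G <= H)%MS.
Local Notation pat := (pat G).
Local Notation patT_ := [set: {set 'I_k}]%SET.
Variable lam : 'I_k -> R.
Hypothesis lamH : forall w : 'rV[R]_k, (w <= H)%MS <-> pairing lam w = 0.
Hypothesis lam_neq0 : exists i, lam i != 0.

Lemma dependency_lam : dependency G lam.
Proof.
move=> l; have /lamH : (l *m G <= H)%MS by apply: submx_trans (submxMl _ _) GH.
exact.
Qed.

Lemma lower0 la (w : 'rV[R]_k) : lower la w 0 = w.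
Proof. by apply/rowP => i; rewrite mxE mul0r subr0. Qed.

Lemma lower_mix la (w : 'rV[R]_k) c s :
  (1 - s) *: lower la w c + s *: w = lower la w ((1 - s) * c).
Proof. by apply/rowP => i; rewrite !mxE; ring. Qed.

Lemma sum_lam : \sum_i lam i = 0.
Proof.
rewrite -[RHS](dependency_lam e1); apply: eq_bigr => i _.
by rewrite (ev_e1 e1G) mulr1.
Qed.

Lemma pos_mass_gt0 (la : 'I_k -> R) : \sum_i la i = 0 -> (exists i, la i != 0) -> 0 < pos_mass la.
Proof.
move=> s0 [j ljn]; have pm0 : 0 <= pos_mass la.
  by apply: sumr_ge0 => i; rewrite inE => /ltW.
rewrite lt0r pm0 andbT; apply/negP; rewrite psumr_eq0 => [/allP pz|i]; last first.
  by rewrite inE => /ltW.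
have neg i : la i <= 0.
  rewrite leNgt; apply/negP => li; have := pz i (mem_index_enum _).
  by rewrite inE li /= gt_eqF.
have /eqP : \sum_i - la i = 0 by rewrite sumrN s0 oppr0.
rewrite psumr_eq0 => [/allP /(_ j (mem_index_enum _))|i _]; last by rewrite oppr_ge0.
by rewrite /= oppr_eq0 (negPf ljn).
Qed.

Let laN i := - lam i.

Lemma pos_mass_lam : 0 < pos_mass lam.
Proof. exact: pos_mass_gt0 sum_lam lam_neq0. Qed.

Lemma pos_mass_laN : 0 < pos_mass laN.
Proof.
apply: pos_mass_gt0; first by rewrite sumrN sum_lam oppr0.
by have [i li] := lam_neq0; exists i; rewrite oppr_eq0.
Qed.

(** The numerators are the positive parts of [pairing lam w] and of its opposite, divided by what
    lowering by 1 removes. At most one is nonzero, and the single formula makes continuity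
    immediate. *)
Definition retract (w : 'rV[R]_k) : 'rV[R]_k :=
  lower laN (lower lam w ((`|pairing lam w| + pairing lam w) / 2 / pos_mass lam))
            ((`|pairing lam w| - pairing lam w) / 2 / pos_mass laN).

Lemma retract_ge0 w : 0 <= pairing lam w ->
  retract w = lower lam w (pairing lam w / pos_mass lam).
Proof.
move=> pw; rewrite /retract ger0_norm // subrr !mul0r lower0; congr (lower _ _ (_ / _)).
by field.
Qed.

Lemma retract_le0 w : pairing lam w <= 0 ->
  retract w = lower laN w (pairing laN w / pos_mass laN).
Proof.
move=> pw; rewrite /retract ler0_norm // addNr !mul0r lower0 pairingN.
by congr (lower _ _ (_ / _)); field.
Qed.

Lemma pairing_retract w : pairing lam (retract w) = 0.
Proof.
have [pw|/ltW pw] := leP 0 (pairing lam w).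
  by rewrite retract_ge0 // pairing_lower divfK ?subrr // gt_eqF ?pos_mass_lam.
apply/eqP; rewrite -oppr_eq0 -pairingN retract_le0 // pairing_lower divfK ?subrr //.
by rewrite gt_eqF ?pos_mass_laN.
Qed.

Lemma retract_id w : pairing lam w = 0 -> retract w = w.
Proof. by move=> pw; rewrite retract_ge0 ?pw // mul0r lower0. Qed.

(** On the segment the lowering constant is [1 - s] times the final one, so the pairing only drops
    to [s] times its value and [balanced_lower] applies. *)
Lemma retract_mix la (w : 'rV[R]_k) s : dependency G la -> 0 < pos_mass la ->
  balanced la (pat w) -> pat w != patT_ -> 0 <= pairing la w -> unit_int s ->
  let x := (1 - s) *: lower la w (pairing la w / pos_mass la) + s *: w in
  is_true (balanced la (pat x) && (pat x != patT_)).
Proof.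
move=> dl m0 bal wT pw0 s01 x; move: (unit_intP s01) => [s0 s1].
move: pw0; rewrite le_eqVlt => /predU1P[e|pos].
  by rewrite /x -e mul0r lower0 -scalerDl subrK scale1r bal.
rewrite /x lower_mix; apply/andP; apply: balanced_lower => //.
  by rewrite mulr_ge0 // divr_ge0 ?ltW.
rewrite pairing_lower -mulrA divfK ?gt_eqF // mulrBl mul1r opprB addrC subrK.
by rewrite mulr_ge0 // ltW.
Qed.

Definition radonX : {set {set {set 'I_k}}} := [set Z | realizable G Z && balanced lam Z].

Lemma radonX_realizable Z : Z \in radonX -> realizable G Z.
Proof. by rewrite inE => /andP[]. Qed.

Lemma mem_radonX w : (pat w \in radonX) = balanced lam (pat w) && (pat w != patT_).
Proof.
rewrite inE andbC; congr (_ && _); apply/idP/idP; last exact: realizable_pat.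
by move=> /andP[].
Qed.

Lemma pairing_continuous : continuous (pairing lam).
Proof.
apply: (@continuous_bigsum R R^o) => i _.
rewrite (_ : (fun w : 'rV[R]_k => _) = fun w : 'rV[R]_k => w 0 i * lam i).
  by apply: continuous_mulr; apply: continuous_coord.
by apply/funext => w; rewrite mulrC.
Qed.

Lemma within_lower (T : topologicalType) (A : set T) la (f : T -> 'rV[R]_k) (c : T -> R) :
  {within A, continuous f} -> {within A, continuous c} ->
  {within A, continuous (fun x => lower la (f x) (c x))}.
Proof.
move=> fc cc; apply: within_row => i.
rewrite (_ : (fun x => _) = fun x => f x 0 i + - (c x * (i \in pos_part la)%:R)).
  apply: within_add; first exact: within_coord.
  by apply: within_opp; apply: within_mul => //; apply: within_cst.
by apply/funext => x; rewrite mxE.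
Qed.

Lemma retract_continuous : continuous retract.
Proof.
apply/continuous_subspace_setT.
have pc : {within setT, continuous (pairing lam)}.
  exact/continuous_subspaceT/pairing_continuous.
have nc : {within setT, continuous (fun w => `|pairing lam w|)}.
  by apply: (@within_compT _ _ _ _ (pairing lam) (@Num.norm R R)) => //; apply: norm_continuous.
have idc : {within setT, continuous (@id 'rV[R]_k)}.
  by apply: continuous_subspaceT => x; apply: cvg_id.
apply: within_lower; first apply: within_lower => //.
  apply: within_mul; last exact: within_cst.
  by apply: within_mul; [apply: within_add|exact: within_cst].
apply: within_mul; last exact: within_cst.
by apply: within_mul; [apply: within_add => //; apply: within_opp|exact: within_cst].
Qed.

Theorem radon_sphere d : \rank H = (d + \rank G)%N ->
  homotopy_equiv R
    (realization (fun Z Z' : {set {set 'I_k}} => Z \subset Z')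
       (enum_val : 'I_#|radonX| -> {set {set 'I_k}}) : set 'rV[R]_#|radonX|)
    (@usphere R d).
Proof.
move=> rk; have [B [C [BH BC GC HG]]] := complement_coords GH rk.
apply: (@fan_sphere _ _ _ _ _ e1G _ radonX_realizable d B C retract) => //.
- exact: retract_continuous.
- by move=> w; apply/HG/lamH/pairing_retract.
- move=> w s; rewrite !mem_radonX => /andP[bal wT] s01.
  have [pw|/ltW pw] := leP 0 (pairing lam w).
    rewrite retract_ge0 //; apply: retract_mix => //; first exact: dependency_lam.
    exact: pos_mass_lam.
  rewrite retract_le0 // -balancedN; apply: retract_mix => //.
  - exact/dependencyN/dependency_lam.
  - exact: pos_mass_laN.
  - by rewrite balancedN.
  - by rewrite pairingN oppr_ge0.
- move=> u; apply: retract_id; apply/lamH.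
  exact: submx_trans (submxMl _ _) BH.
move=> u u0; rewrite mem_radonX balanced0 /=; last 2 first.
- exact: dependency_lam.
- by apply/lamH; apply: submx_trans (submxMl _ _) BH.
apply: contra u0 => /eqP /patT /submxP[l e].
by rewrite -[u]mulmx1 -BC mulmxA e -mulmxA GC mulmx0.
Qed.

End RadonSphere.

(** * Point configurations and subdivisions *)

Section PointConfiguration.
Variables (R : realType) (d k : nat) (a : 'I_k -> 'rV[R]_d).

Definition homog : 'M[R]_(d + 1, k) := col_mx (\matrix_(j, i) a i 0 j) (const_mx 1).
Definition aff (l : 'rV[R]_(d + 1)) (x : 'rV[R]_d) : R :=
  dotv (lsubmx l) x + rsubmx l 0 0.
Definition mk_aff (c : 'rV[R]_d) (b : R) : 'rV[R]_(d + 1) := row_mx c b%:M.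
Local Notation ev := (ev homog).
Local Notation below := (below homog).
Local Notation contact := (contact homog).
Local Notation hull_of Z := (convf a (mem (Z : {set 'I_k}))).
Local Notation zeros Z l := ([set i in (Z : {set 'I_k}) | ev l i == 0]%SET).
Implicit Types (Z : {set 'I_k}) (w : 'rV[R]_k) (l : 'rV[R]_(d + 1)).

Lemma aff_mk c b x : aff (mk_aff c b) x = dotv c x + b.
Proof. by rewrite /aff row_mxKl row_mxKr mxE. Qed.

Lemma ev_homog l i : ev l i = aff l (a i).
Proof.
change ((l *m homog) 0 i = aff l (a i)).
rewrite /aff -{1}(hsubmxK l) mul_row_col [LHS]mxE; congr (_ + _).
  by rewrite [LHS]mxE; apply: eq_bigr => j _; rewrite [X in _ * X = _]mxE.
by rewrite [LHS]mxE big_ord1 [X in _ * X = _]mxE mulr1.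
Qed.

Definition unit_aff : 'rV[R]_(d + 1) := mk_aff 0 1.

Lemma unit_affG i : (unit_aff *m homog) 0 i = 1.
Proof.
have := ev_homog unit_aff i; rewrite aff_mk /dotv big1 ?add0r //.
by move=> j _; rewrite mxE mul0r.
Qed.

Lemma dotv_sum (I : finType) c (mu : I -> R) (b : I -> 'rV[R]_d) :
  dotv c (\sum_i mu i *: b i) = \sum_i mu i * dotv c (b i).
Proof.
rewrite /dotv; under eq_bigr do rewrite summxE mulr_sumr.
rewrite exchange_big; apply: eq_bigr => i _; rewrite mulr_sumr.
by apply: eq_bigr => j _; rewrite mxE mulrCA.
Qed.

Lemma aff_comb l (mu : 'I_k -> R) : \sum_i mu i = 1 ->
  aff l (\sum_i mu i *: a i) = \sum_i mu i * ev l i.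
Proof.
move=> m1; rewrite /aff dotv_sum -[X in _ + X]mul1r -m1 mulr_suml -big_split.
by apply: eq_bigr => i _; rewrite ev_homog /aff mulrDr.
Qed.

Lemma same_moment_comb (mu nu : 'I_k -> R) :
  \sum_i mu i = 1 -> \sum_i nu i = 1 ->
  \sum_i mu i *: a i = \sum_i nu i *: a i -> same_moment homog mu nu.
Proof. by move=> m1 n1 e l; rewrite -!aff_comb // e. Qed.

Lemma same_moment_point (mu nu : 'I_k -> R) : \sum_i mu i = 1 -> \sum_i nu i = 1 ->
  same_moment homog mu nu -> \sum_i mu i *: a i = \sum_i nu i *: a i.
Proof.
move=> m1 n1 mm; apply/rowP => j.
have aff_delta x : aff (mk_aff (delta_mx 0 j) 0) x = x 0 j.
  rewrite aff_mk addr0 /dotv (bigD1 j) //= mxE !eqxx mul1r big1 ?addr0 // => i ij.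
  by rewrite mxE (negPf ij) mul0r.
by rewrite -!aff_delta !aff_comb //.
Qed.

Lemma hull_ofP Z x : hull_of Z x -> exists mu : 'I_k -> R,
  [/\ forall i, 0 <= mu i, forall i, i \notin Z -> mu i = 0,
      \sum_i mu i = 1 & x = \sum_i mu i *: a i].
Proof. by move=> [mu [m0 [mZ [m1 ->]]]]; exists mu. Qed.

Lemma convf_point (I : pred 'I_k) i : I i -> convf a I (a i).
Proof.
move=> Ii; exists (fun j => (j == i)%:R); split; first by move=> j; rewrite ler0n.
split; first by move=> j; case: eqP => // ->; rewrite Ii.
split; first by rewrite (bigD1 i) //= eqxx big1 ?addr0 // => j /negPf->.
by rewrite (bigD1 i) //= eqxx scale1r big1 ?addr0 // => j /negPf->; rewrite scale0r.
Qed.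

Lemma convf_subset (I J : pred 'I_k) : (forall i, I i -> J i) -> convf a I `<=` convf a J.
Proof.
move=> IJ x [mu [m0 [mI [m1 ->]]]]; exists mu; split=> //; split=> // i nJ.
by apply: mI; apply: contra nJ; apply: IJ.
Qed.

Lemma convf_setT : convf a predT = hull_of [set: 'I_k]%SET.
Proof.
apply/seteqP; split; apply: convf_subset => i //= _.
exact: finset.in_setT.
Qed.

Lemma convf_convex (q : nat) (b : 'I_q -> 'rV[R]_d) (J : pred 'I_q) (I : pred 'I_k) :
  (forall j, J j -> convf a I (b j)) -> convf b J `<=` convf a I.
Proof.
move=> bI x [lam [l0 [lJ [l1 ->]]]].
have /choice[mu Hmu] : forall j, exists mu : 'I_k -> R, J j ->
     (forall i, 0 <= mu i) /\ (forall i, ~~ I i -> mu i = 0) /\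
     \sum_i mu i = 1 /\ b j = \sum_i mu i *: a i.
  move=> j; have [Jj|Jj] := boolP (J j); last by exists (fun=> 0).
  by have [mu Hmu] := bI j Jj; exists mu.
exists (fun i => \sum_j lam j * mu j i); split.
  move=> i; apply: sumr_ge0 => j _; have [Jj|Jj] := boolP (J j).
    by rewrite mulr_ge0 //; have [H _] := Hmu j Jj.
  by rewrite lJ // mul0r.
split.
  move=> i nI; apply: big1 => j _; have [Jj|Jj] := boolP (J j).
    by have [_ [H _]] := Hmu j Jj; rewrite H // mulr0.
  by rewrite lJ // mul0r.
split.
  rewrite exchange_big /= -[RHS]l1; apply: eq_bigr => j _; rewrite -mulr_sumr.
  have [Jj|Jj] := boolP (J j); last by rewrite lJ // mul0r.
  by have [_ [_ [-> _]]] := Hmu j Jj; rewrite mulr1.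
under [RHS]eq_bigr do rewrite scaler_suml.
rewrite exchange_big /=; apply: eq_bigr => j _.
have [Jj|Jj] := boolP (J j); last first.
  by rewrite lJ // scale0r big1 // => i _; rewrite mul0r scale0r.
have [_ [_ [_ ->]]] := Hmu j Jj; rewrite scaler_sumr.
by apply: eq_bigr => i _; rewrite scalerA.
Qed.

Lemma hull_of_polytope Z : Z != finset.set0 -> polytope (hull_of Z).
Proof.
move=> /finset.set0Pn[i0 i0Z]; split; last by exists (a i0); apply: convf_point.
exists [seq a i | i <- enum Z]; rewrite /conv; apply/seteqP; split; last first.
  apply: convf_convex => j _.
  have jZ : (j < size (enum Z))%N by rewrite -(size_map a) ltn_ord.
  rewrite (nth_map i0) //; apply: convf_point.
  by rewrite /= -mem_enum mem_nth.
move=> x [mu [m0 [mZ [m1 ->]]]].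
exists (fun j => mu (nth i0 (enum Z) j)); split=> //; split=> //.
have sumE (V : zmodType) (F : 'I_k -> V) : (forall i, i \notin Z -> F i = 0) ->
    \sum_(j < size [seq a i | i <- enum Z]) F (nth i0 (enum Z) j) = \sum_i F i.
  move=> F0; rewrite (bigID (mem Z)) /= [X in _ = _ + X]big1 ?addr0; last first.
    by move=> i; apply: F0.
  by rewrite -[RHS]big_enum /= (big_nth i0) big_mkord size_map.
split; first by rewrite sumE.
rewrite -(sumE _ (fun i => mu i *: a i)); last by move=> i /mZ ->; rewrite scale0r.
apply: eq_bigr => j _; rewrite (nth_map i0) //.
by rewrite -(size_map a) ltn_ord.
Qed.

Lemma hull_of_aff_ge0 Z l x : (forall i, i \in Z -> 0 <= ev l i) ->
  hull_of Z x -> 0 <= aff l x.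
Proof.
move=> l0 /hull_ofP[mu [m0 mZ m1 ->]]; rewrite aff_comb //; apply: sumr_ge0 => i _.
have [iZ|/mZ ->] := boolP (i \in Z); last by rewrite mul0r.
by rewrite mulr_ge0 // l0.
Qed.

Lemma hull_of_aff_eq0 Z l x : (forall i, i \in Z -> ev l i = 0) ->
  hull_of Z x -> aff l x = 0.
Proof.
move=> l0 /hull_ofP[mu [m0 mZ m1 ->]]; rewrite aff_comb //; apply: big1 => i _.
have [iZ|/mZ ->] := boolP (i \in Z); last by rewrite mul0r.
by rewrite l0 // mulr0.
Qed.

Lemma support_zeros Z l (mu : 'I_k -> R) : (forall i, i \in Z -> 0 <= ev l i) ->
  (forall i, 0 <= mu i) -> (forall i, i \notin Z -> mu i = 0) -> \sum_i mu i = 1 ->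
  aff l (\sum_i mu i *: a i) = 0 -> forall i, i \notin zeros Z l -> mu i = 0.
Proof.
move=> l0 m0 mZ m1; rewrite aff_comb // => /eqP; rewrite psumr_eq0 => [/allP H|i _].
  move=> i; rewrite inE; have [iZ|/mZ //] := boolP (i \in Z) => /= li.
  have := H i (mem_index_enum _); rewrite /= mulf_eq0 (negPf li) orbF.
  by move/eqP.
have [iZ|/mZ ->] := boolP (i \in Z); last by rewrite mul0r.
by rewrite mulr_ge0 // l0.
Qed.

Lemma hull_of_zeros Z l x : (forall i, i \in Z -> 0 <= ev l i) ->
  hull_of Z x -> aff l x = 0 -> hull_of (zeros Z l) x.
Proof.
move=> l0 /hull_ofP[mu [m0 mZ m1 ->]] e; exists mu; split=> //; split=> //.
exact: support_zeros e.
Qed.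

Lemma minimizers_hull_of Z l : (forall i, i \in Z -> 0 <= ev l i) ->
  (exists2 i, i \in Z & ev l i = 0) ->
  [set x | hull_of Z x /\
     forall y, hull_of Z y -> dotv (lsubmx l) x <= dotv (lsubmx l) y]
  = hull_of (zeros Z l).
Proof.
move=> l0 [i iZ li]; apply/seteqP; split=> x /=.
  move=> [xZ xmin]; apply: hull_of_zeros => //; apply/eqP; rewrite eq_le.
  rewrite (hull_of_aff_ge0 l0 xZ) andbT -li ev_homog /aff lerD2r.
  by apply/xmin/convf_point.
move=> xz; split.
  by apply: convf_subset xz => j; rewrite /= inE => /andP[].
move=> y /(hull_of_aff_ge0 l0); rewrite -(@hull_of_aff_eq0 (zeros Z l) l x) //.
  by rewrite /aff lerD2r.
by move=> j; rewrite inE => /andP[_ /eqP].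
Qed.

Lemma face_hull_of Z l : (forall i, i \in Z -> 0 <= ev l i) ->
  (exists2 i, i \in Z & ev l i = 0) -> face (hull_of Z) (hull_of (zeros Z l)).
Proof. by move=> l0 li; exists (lsubmx l); rewrite minimizers_hull_of. Qed.

Lemma face_hull_ofP Z F : Z != finset.set0 -> face (hull_of Z) F ->
  exists l, [/\ forall i, i \in Z -> 0 <= ev l i, exists2 i, i \in Z & ev l i = 0 &
    F = hull_of (zeros Z l)].
Proof.
move=> /finset.set0Pn[i0 i0Z] [c ->].
pose i1 := [arg min_(i < i0 | i \in Z) dotv c (a i)]%O.
have [i1Z i1min] : i1 \in Z /\ forall i, i \in Z -> dotv c (a i1) <= dotv c (a i).
  by rewrite /i1; case: arg_minP => // i iZ H; split.
pose l := mk_aff c (- dotv c (a i1)).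
have l0 i : i \in Z -> 0 <= ev l i.
  by move=> iZ; rewrite ev_homog aff_mk subr_ge0 i1min.
have l1 : exists2 i, i \in Z & ev l i = 0.
  by exists i1 => //; rewrite ev_homog aff_mk subrr.
exists l; split=> //; rewrite -minimizers_hull_of //.
by rewrite /l /mk_aff row_mxKl.
Qed.

Lemma hull_of_neq0 Z x : hull_of Z x -> Z != finset.set0.
Proof.
move=> /hull_ofP[mu [_ mZ m1 _]]; apply/eqP => Z0.
move: (oner_neq0 R); rewrite -m1 big1 ?eqxx // => i _.
by apply: mZ; rewrite Z0 finset.in_set0.
Qed.

(** Duality for the weights of [x]: the optimal measure still represents [x] and lives on the
    contact of the dual function. *)
Lemma cells_cover w x : convf a predT x ->
  exists2 l, below l w & hull_of (contact l w) x.
Proof.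
move=> [lam [l0 [_ [l1 ->]]]].
have [mu [l [m0 mm lw sl]]] := lp_duality unit_affG w l0.
exists l => //; exists mu; split=> //; split=> //.
have m1 : \sum_i mu i = 1 by rewrite (same_moment_mass unit_affG mm).
by split=> //; apply/esym/same_moment_point.
Qed.

(** The weights placing [x] in the first hull are optimal, hence also supported on the second
    contact. *)
Lemma cells_meet w l1 l2 x : below l1 w -> below l2 w ->
  hull_of (contact l1 w) x -> hull_of (contact l2 w) x ->
  hull_of (contact l1 w :&: contact l2 w) x.
Proof.
move=> l1w l2w /hull_ofP[mu [m0 mZ m1 e1]] /hull_ofP[nu [n0 nZ n1 e2]].
have mm : same_moment homog mu nu by apply: same_moment_comb => //; rewrite -e1.
exists mu; split=> //; split=> // i /=.
rewrite finset.in_setI negb_and => /orP[/mZ //|ni].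
apply/eqP/negPn/negP => mi.
have := support_transfer m0 n0 mm l1w l2w mZ nZ (i := i).
by rewrite lt0r mi m0 => /(_ isT); rewrite (negPf ni).
Qed.

Lemma barycenter_ex Z : Z != finset.set0 -> exists mu : 'I_k -> R,
  [/\ forall i, 0 <= mu i, forall i, (0 < mu i) = (i \in Z) & \sum_i mu i = 1].
Proof.
move=> Z0; have c0 : (0 < #|Z|%:R :> R) by rewrite ltr0n card_gt0.
exists (fun i => (#|Z|%:R)^-1 * (i \in Z)%:R); split.
- by move=> i; rewrite mulr_ge0 ?invr_ge0 ?ler0n.
- by move=> i; case: (i \in Z); rewrite ?mulr1 ?mulr0 ?invr_gt0 ?ltxx.
rewrite -mulr_sumr -natr_sum.
rewrite (_ : (\sum_i (i \in Z))%N = #|Z|) ?mulVf ?gt_eqF //.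
by rewrite -sum1_card [RHS]big_mkcond; apply: eq_bigr => i _; case: (i \in Z).
Qed.

End PointConfiguration.

(** * Cells cut out by a height vector, upstairs and downstairs *)

Section Cells.
Variables (R : realType) (n m k : nat) (v : 'I_k -> 'rV[R]_n) (A : 'M[R]_(n, m)).
Definition proj_conf (i : 'I_k) : 'rV[R]_m := v i *m A.
Local Notation a := proj_conf.
Local Notation evv := (ev (homog v)).
Local Notation ev := (ev (homog a)).
Local Notation below := (below (homog a)).
Local Notation contact := (contact (homog a)).
Local Notation pat := (pat (homog a)).
Local Notation hull_v Z := (convf v (mem (Z : {set 'I_k}))).
Local Notation hull_a Z := (convf a (mem (Z : {set 'I_k}))).
Local Notation pi := (fun x : 'rV[R]_n => x *m A).
Implicit Types (Z : {set 'I_k}) (w : 'rV[R]_k) (l : 'rV[R]_(m + 1)).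

Lemma aff_proj l x :
  aff l (x *m A) = aff (row_mx (lsubmx l *m A^T) (rsubmx l)) x.
Proof.
rewrite /aff row_mxKl row_mxKr; congr (_ + _); rewrite /dotv.
transitivity (\sum_j \sum_i lsubmx l 0 j * (x 0 i * A i j)).
  by apply: eq_bigr => j _; rewrite [X in _ * X]mxE mulr_sumr.
rewrite exchange_big; apply: eq_bigr => i _; rewrite [X in _ = X * _]mxE mulr_suml.
by apply: eq_bigr => j _; rewrite [A^T _ _]mxE; ring.
Qed.

Lemma homog_proj : (homog a <= homog v)%MS.
Proof.
apply/row_subP => i; rewrite rowE; set l := delta_mx _ _.
suff -> : l *m homog a = row_mx (lsubmx l *m A^T) (rsubmx l) *m homog v.
  exact: submxMl.
apply/rowP => j; change (ev l j = evv (row_mx (lsubmx l *m A^T) (rsubmx l)) j).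
by rewrite !ev_homog; apply: aff_proj.
Qed.

Lemma proj_comb (mu : 'I_k -> R) : (\sum_i mu i *: v i) *m A = \sum_i mu i *: a i.
Proof. by rewrite mulmx_suml; apply: eq_bigr => i _; rewrite -scalemxAl. Qed.

Lemma proj_convf (I : pred 'I_k) : pi @` convf v I = convf a I.
Proof.
apply/seteqP; split=> [_ [_ [mu [m0 [mI [m1 ->]]]] <-]|_ [mu [m0 [mI [m1 ->]]]]].
  by exists mu; rewrite proj_comb.
by exists (\sum_i mu i *: v i); [exists mu|rewrite proj_comb].
Qed.

Definition is_cell w Z := Z != finset.set0 /\ exists2 l, below l w & contact l w = Z.

(** The hulls are taken in the space of [P] because the Baues poset consists of labels and not of
    their images. *)
Definition cells w : set (set 'rV[R]_n) := [set hull_v Z | Z in [set Z | is_cell w Z]].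

Lemma support_in_cell w l l' mu : below l w -> below l' w ->
  (forall i, 0 <= mu i) -> (forall i, i \notin contact l w -> mu i = 0) ->
  \sum_i mu i = 1 -> hull_a (contact l' w) (\sum_i mu i *: a i) ->
  forall i, 0 < mu i -> i \in contact l' w.
Proof.
move=> lw l'w m0 mZ m1 /hull_ofP[nu [n0 nZ n1 e]].
exact: support_transfer (same_moment_comb m1 n1 e) lw l'w mZ nZ.
Qed.

(** Tested at a point with positive weight on every label of [Z]: if it lies in [hull_a Z'], all
    these labels must be tight there. *)
Lemma cell_subset w Z Z' : is_cell w Z -> is_cell w Z' ->
  hull_a Z `<=` hull_a Z' -> Z \subset Z'.
Proof.
move=> [Z0 [l lw lZ]] [_ [l' l'w lZ']] sub.
have [mu [m0 mZ m1]] := barycenter_ex R Z0.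
have mZ' i : i \notin Z -> mu i = 0.
  by rewrite -mZ lt0r m0 andbT negbK => /eqP.
have : hull_a Z' (\sum_i mu i *: a i) by apply: sub; exists mu.
rewrite -lZ' => inZ'; apply/fintype.subsetP => i iZ.
rewrite -lZ in mZ'.
by apply: (support_in_cell lw l'w m0 mZ' m1 inZ'); rewrite mZ.
Qed.

Lemma cells_image w : [set pi @` F | F in cells w] = [set hull_a Z | Z in [set Z | is_cell w Z]].
Proof.
apply/seteqP; split=> [_ [_ [Z cZ <-] <-]|_ [Z cZ <-]].
  by exists Z; rewrite ?proj_convf.
by exists (hull_v Z); [exists Z|rewrite proj_convf].
Qed.

Lemma cells_polysubdiv w :
  polysubdiv (convf a predT) [set hull_a Z | Z in [set Z | is_cell w Z]].
Proof.
split.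
- by apply: finite_image; apply: finite_finset.
- by move=> _ [Z [Z0 _] <-]; apply: hull_of_polytope.
- move=> _ F [Z [Z0 [l' lw' lZ]] <-] /(face_hull_ofP Z0)[l [l0 [i iZ li] ->]].
  exists [set i in Z | ev l i == 0]%SET => //; split.
    by apply/finset.set0Pn; exists i; rewrite inE iZ li eqxx.
  rewrite -lZ in l0 *.
  by have [l'' lw'' cl] := contact_perturb lw' l0; exists l''.
- move=> _ _ [Z1 [Z10 [l1 l1w <-]] <-] [Z2 [Z20 [l2 l2w <-]] <-].
  have [[x [x1 x2]]|none] := pselect ((hull_a (contact l1 w) `&` hull_a (contact l2 w)) !=set0); last first.
    by left; apply/seteqP; split=> // x xx; case: none; exists x.
  right.
  have Zn0 : contact l1 w :&: contact l2 w != finset.set0.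
    exact: hull_of_neq0 (cells_meet l1w l2w x1 x2).
  have -> : hull_a (contact l1 w) `&` hull_a (contact l2 w) =
      hull_a (contact l1 w :&: contact l2 w).
    apply/seteqP; split=> y; first by move=> [y1 y2]; apply: cells_meet.
    move=> yI; split; apply: convf_subset yI => i /=; rewrite finset.in_setI => /andP[] //.
  have [i0] := finset.set0Pn _ Zn0; rewrite finset.in_setI => /andP[i01 i02].
  (* On the contact of [la], where [la] agrees with [w], the difference [la - lb] is nonnegative and
     vanishes exactly where [lb] is tight. *)
  have facet la lb : below la w -> below lb w -> i0 \in contact la w -> i0 \in contact lb w ->
      face (hull_a (contact la w)) (hull_a (contact la w :&: contact lb w)).
    move=> law lbw i0a i0b.
    have -> : contact la w :&: contact lb w
        = [set i in contact la w | ev (la - lb) i == 0]%SET.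
      apply/setP => i; rewrite finset.in_setI [RHS]finset.in_set.
      have [|//] := boolP (i \in contact la w); rewrite inE => /eqP e.
      by rewrite inE evB e subr_eq0 eq_sym.
    apply: face_hull_of.
      by move=> i; rewrite inE evB => /eqP ->; rewrite subr_ge0.
    exists i0 => //; move: i0a i0b; rewrite !inE evB => /eqP -> /eqP ->.
    by rewrite subrr.
  split; first exact: facet.
  by rewrite finset.setIC; apply: facet.
apply/seteqP; split=> [x [_ [Z _ <-]]|x /(cells_cover w)[l lw xl]].
  by apply: convf_subset.
exists (hull_a (contact l w)) => //; exists (contact l w) => //.
by split; [apply: hull_of_neq0 xl|exists l].
Qed.

(** [Z] lies in a contact of some [l'] for [w'], which in turn lies in a contact of some [l2] for
    [w]. On the contact of [l'] the function [l2 - l] is nonnegative with zero set [Z], so tilting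
    [l'] by it cuts out [Z]. *)
Lemma is_cell_pat w w' Z : pat w = pat w' -> is_cell w Z -> is_cell w' Z.
Proof.
move=> e [Z0 [l lw lZ]]; split=> //.
have /patP[l' [lw' sub]] : Z \in pat w' by rewrite -e; apply: (mem_pat_contact lw); rewrite lZ.
have /patP[l2 [l2w sub2]] : contact l' w' \in pat w by rewrite e; apply: (mem_pat_contact lw').
have [|l'' lw'' cl] := @contact_perturb _ _ _ _ l' (l2 - l) w' lw'.
  move=> i /(fintype.subsetP sub2); rewrite inE evB => /eqP ->.
  by rewrite subr_ge0.
exists l'' => //; rewrite cl; apply/setP => i; rewrite [LHS]finset.in_set.
apply/andP/idP => [[il' /eqP]|iZ].
  move: il' => /(fintype.subsetP sub2); rewrite inE evB => /eqP -> /eqP.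
  by rewrite subr_eq0 eq_sym -lZ inE.
have il' := fintype.subsetP sub _ iZ; split=> //.
move: (fintype.subsetP sub2 _ il') iZ; rewrite -lZ !inE evB => /eqP -> /eqP ->.
by rewrite subrr.
Qed.

Lemma cells_pat w w' : pat w = pat w' -> cells w = cells w'.
Proof.
by move=> e; apply/seteqP; split=> _ [Z cZ <-]; exists Z => //; apply: is_cell_pat cZ.
Qed.

Variable lam : 'I_k -> R.
Hypothesis lamV : forall w, (w <= homog v)%MS <-> pairing lam w = 0.

Lemma lam_dependency : dependency (homog a) lam.
Proof. exact: (dependency_lam homog_proj lamV). Qed.

(** Heights annihilated by [lam] are values of affine functions on the space of [P]; through
    [slack_lift], balance thus turns a cell into the vertex set of a face. *)
Lemma cell_functional w Z : balanced lam (pat w) -> is_cell w Z ->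
  exists l : 'rV[R]_(n + 1), forall i, 0 <= evv l i /\ (evv l i == 0) = (i \in Z).
Proof.
move=> bal [_ [l lw <-]].
have [y /lamV /submxP[lv ->] H] := slack_lift lam_dependency bal lw.
by exists lv => i; have := H i; rewrite ev_row mxE.
Qed.

Lemma cell_support w Z mu : balanced lam (pat w) -> is_cell w Z ->
  (forall i, 0 <= mu i) -> \sum_i mu i = 1 -> hull_v Z (\sum_i mu i *: v i) ->
  forall i, i \notin Z -> mu i = 0.
Proof.
move=> bal cZ m0 m1 xZ; have [l lP] := cell_functional bal cZ.
have zE : [set i in [set: 'I_k]%SET | evv l i == 0]%SET = Z.
  by apply/setP => i; rewrite [LHS]finset.in_set finset.in_setT; have [_ ->] := lP i.
rewrite -zE; apply: support_zeros => //.
- by move=> i _; have [] := lP i.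
- by move=> i; rewrite finset.in_setT.
- apply: (hull_of_aff_eq0 (Z := Z)) xZ => i iZ.
  by have [_] := lP i; rewrite iZ => /eqP.
Qed.

Lemma cells_induced w : balanced lam (pat w) -> pi_induced pi (convf v predT) (cells w).
Proof.
move=> bal; split.
- move=> _ [Z cZ <-]; have [l lP] := cell_functional bal cZ.
  have zE : [set i in [set: 'I_k]%SET | evv l i == 0]%SET = Z.
    by apply/setP => i; rewrite [LHS]finset.in_set finset.in_setT; have [_ ->] := lP i.
  rewrite convf_setT -{1}zE; apply: face_hull_of => [i _|]; first by have [] := lP i.
  have [/finset.set0Pn[i iZ] _] := cZ; exists i; first exact: finset.in_setT.
  by have [_] := lP i; rewrite iZ => /eqP.
- by rewrite proj_convf cells_image; apply: cells_polysubdiv.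
move=> _ _ [Z cZ <-] [Z' cZ' <-]; rewrite !proj_convf => sub.
have subZ := cell_subset cZ cZ' sub.
apply/seteqP; split=> x.
  move=> xZ; split; first by apply: convf_subset xZ => i /=; apply: (fintype.subsetP subZ).
  by rewrite /preimage /= -proj_convf; exists x.
move=> [/hull_ofP[mu [m0 mZ m1 ->]]]; rewrite /preimage /= proj_comb => xZ.
exists mu; split=> //; split=> // i iZ.
move: cZ cZ' mZ xZ iZ => [_ [l lw <-]] [_ [l' lw' <-]] mZ xZ iZ.
apply/eqP/negPn/negP => mi; move/negP: iZ; apply.
by apply: (support_in_cell lw' lw m0 mZ m1 xZ); rewrite lt0r mi m0.
Qed.

(** Tested at the barycenter of a contact: balance makes [hull_v Z'] a face of [P], so a point in it
    has all its labels in [Z']. *)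
Lemma cells_le w w' : balanced lam (pat w') ->
  baues_le (cells w) (cells w') <-> pat w \subset pat w'.
Proof.
move=> bal; split=> [le|sub].
  apply/fintype.subsetP => s /patP[l [lw sl]].
  have [Z0|Z0] := eqVneq (contact l w) finset.set0.
    move: sl; rewrite Z0 finset.subset0 => /eqP ->.
    exact: (set0_pat (unit_affG a)).
  have [mu [m0 mZ m1]] := barycenter_ex R Z0.
  have [] := le (\sum_i mu i *: v i).
    exists (hull_v (contact l w)); first by exists (contact l w) => //; split=> //; exists l.
    exists mu; split=> //; split=> // i /=.
    by rewrite -mZ lt0r m0 andbT negbK => /eqP.
  move=> _ [Z' cZ' <-] xZ'.
  have supp := cell_support bal cZ' m0 m1 xZ'.
  have [_ [l' lw' lZ']] := cZ'.
  apply: (mem_pat_contact lw'); rewrite lZ'; apply: (fintype.subset_trans sl).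
  apply/fintype.subsetP => i; rewrite -mZ; apply: contraTT => /supp ->.
  by rewrite ltxx.
move=> x [_ [Z [Z0 [l lw lZ]] <-] xZ].
have /patP[l' [lw' sub']] : Z \in pat w'.
  by apply: (fintype.subsetP sub); apply: (mem_pat_contact lw); rewrite lZ.
exists (hull_v (contact l' w')); last first.
  by apply: convf_subset xZ => i; apply: (fintype.subsetP sub').
exists (contact l' w') => //; split; last by exists l'.
apply: contra Z0 => /eqP e; move: sub'; rewrite e finset.subset0 //.
Qed.

End Cells.

(** * Lower faces of the lifted configuration as contacts *)

Section LowerFaces.
Variables (R : realType) (d k : nat) (a : 'I_k -> 'rV[R]_d).
Variable w : 'I_k -> R.
Local Notation evb_ := (ev (homog (fun i => lift_pt (a i) (w i)))).
Local Notation ev := (ev (homog a)).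
Local Notation below := (below (homog a)).
Local Notation contact := (contact (homog a)).
Local Notation hull_of Z := (convf a (mem (Z : {set 'I_k}))).
Implicit Types (i : 'I_k) (l : 'rV[R]_(d + 1)).
Local Notation wr := (\row_i w i : 'rV[R]_k).
Let b i := lift_pt (a i) (w i).

Lemma dotv_lift (c x : 'rV[R]_d) h : dotv (lift_pt c 1) (lift_pt x h) = dotv c x + h.
Proof.
rewrite /dotv /lift_pt big_split_ord; congr (_ + _).
  by apply: eq_bigr => i _; rewrite !row_mxEl.
by rewrite big_ord1 !row_mxEr !mxE !mulr1n mul1r.
Qed.

Lemma dotvN (c x : 'rV[R]_d) : dotv (- c) x = - dotv c x.
Proof. by rewrite /dotv -sumrN; apply: eq_bigr => i _; rewrite mxE mulNr. Qed.

Lemma proj_lifted_hull (Z : {set 'I_k}) :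
  @proj_pt R d @` convf b (mem Z) = hull_of Z.
Proof.
have projE (mu : 'I_k -> R) : proj_pt (\sum_i mu i *: b i) = \sum_i mu i *: a i.
  rewrite /proj_pt linear_sum; apply: eq_bigr => i _.
  by rewrite linearZ /= /b /lift_pt row_mxKl.
apply/seteqP; split=> [_ [_ [mu [m0 [mI [m1 ->]]]] <-]|_ [mu [m0 [mI [m1 ->]]]]].
  by exists mu; rewrite projE.
by exists (\sum_i mu i *: b i); [exists mu|rewrite projE].
Qed.

(** Up to a constant, the functional with slope [- lsubmx l] and last entry 1 takes the value
    [w i - ev l i] on the lifted points, so it is minimal exactly at the tight labels. *)
Lemma proj_lower_face l : below l wr -> contact l wr != finset.set0 ->
  @proj_pt R d @` [set x | convf b predT x /\ forall y, convf b predT y ->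
     dotv (lift_pt (- lsubmx l) 1) x <= dotv (lift_pt (- lsubmx l) 1) y]
  = hull_of (contact l wr).
Proof.
move=> lw /finset.set0Pn[i0 i0l].
pose lb := mk_aff (lift_pt (- lsubmx l) 1) (- rsubmx l 0 0).
have evb i : evb_ lb i = w i - ev l i.
  by rewrite !ev_homog aff_mk dotv_lift dotvN /aff; ring.
have zE : [set i in [set: 'I_k]%SET | evb_ lb i == 0]%SET = contact l wr.
  apply/setP => i; rewrite [LHS]finset.in_set finset.in_setT inE evb mxE /=.
  by rewrite subr_eq0 eq_sym.
have sE : lsubmx lb = lift_pt (- lsubmx l) 1 by rewrite row_mxKl.
rewrite convf_setT -sE minimizers_hull_of ?zE ?proj_lifted_hull //.
  by move=> i _; rewrite evb subr_ge0; have := lw i; rewrite mxE.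
exists i0; first exact: finset.in_setT.
by apply/eqP; move: i0l; rewrite -zE inE => /andP[].
Qed.

Lemma coherent_cells : (0 < k)%N ->
  [set (@proj_pt R d) @` F | F in [set F | lower_face (convf b predT) F]]
  = [set hull_of Z | Z in
      [set Z | Z != finset.set0 /\ exists2 l, below l wr & contact l wr = Z]].
Proof.
move=> k0; pose i0 := Ordinal k0.
apply/seteqP; split=> [_ [_ [c ->] <-]|_ [Z [Z0 [l lw lZ]] <-]]; last first.
  rewrite -lZ -proj_lower_face ?lZ //.
  by eexists; last reflexivity; exists (- lsubmx l).
pose i1 := [arg min_(i < i0 | true) (dotv c (a i) + w i)]%O.
have i1min i : dotv c (a i1) + w i1 <= dotv c (a i) + w i.
  by rewrite /i1; case: arg_minP => // j _; apply.
(* The constant term raises the function with slope [- c] until it touches the heights from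
   below. *)
pose l := mk_aff (- c) (dotv c (a i1) + w i1).
have cE : c = - lsubmx l by rewrite row_mxKl opprK.
have evl i : ev l i = - dotv c (a i) + (dotv c (a i1) + w i1).
  by rewrite ev_homog aff_mk dotvN.
have lw : below l wr by move=> i; rewrite evl mxE; have := i1min i; lra.
have l0 : contact l wr != finset.set0.
  by apply/finset.set0Pn; exists i1; rewrite inE evl mxE addKr.
exists (contact l wr); first by split=> //; exists l.
by rewrite -proj_lower_face // -cE.
Qed.

End LowerFaces.

Section LowerHull.
Variables (R : realType) (d k : nat) (a : 'I_k -> 'rV[R]_d) (w : 'rV[R]_k).
Local Notation ev := (ev (homog a)).
Local Notation below := (below (homog a)).
Local Notation contact := (contact (homog a)).
Local Notation hull_of Z := (convf a (mem (Z : {set 'I_k}))).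
Implicit Types (i : 'I_k) (l : 'rV[R]_(d + 1)).

Definition hull_at i : R := hull (unit_affG a) [set i]%SET w.

Lemma sum_indic1 i (F : 'I_k -> R) : \sum_j indic R [set i]%SET j * F j = F i.
Proof.
rewrite (bigD1 i) //= /indic finset.in_set1 eqxx mul1r big1 ?addr0 // => j ji.
by rewrite finset.in_set1 (negPf ji) mul0r.
Qed.

Lemma indic1_mass i : \sum_j indic R [set i]%SET j = 1.
Proof. by rewrite -[RHS](sum_indic1 i (fun=> 1)); apply: eq_bigr => j _; rewrite mulr1. Qed.

Lemma indic1_point i : \sum_j indic R [set i]%SET j *: a j = a i.
Proof.
by apply/rowP => c; rewrite summxE -[RHS](sum_indic1 i (fun j => a j 0 c));
  apply: eq_bigr => j _; rewrite mxE.
Qed.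

Lemma hull_at_ge l i : below l w -> ev l i <= hull_at i.
Proof.
move=> lw; have [mu [l' [m0 mm l'w s' e]]] := hullP (unit_affG a) [set i]%SET w.
by rewrite /hull_at e -(sum_indic1 i (ev l)); apply: weak_duality.
Qed.

Lemma hull_at_le i : hull_at i <= w 0 i.
Proof.
by rewrite -(sum_indic1 i (fun j => w 0 j)); apply: hull_le.
Qed.

Lemma hull_at_contact l i : below l w ->
  ev l i = hull_at i <-> hull_of (contact l w) (a i).
Proof.
move=> lw; split=> [e|/hull_ofP[mu [m0 mZ m1 e]]].
  have [mu [l' [m0 mm l'w s' eh]]] := hullP (unit_affG a) [set i]%SET w.
  have m1 : \sum_j mu j = 1 by rewrite (same_moment_mass (unit_affG a) mm) indic1_mass.
  exists mu; split=> //; split.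
    move=> j jl; apply/eqP/negPn/negP => mj; move/negP: jl; apply.
    apply: (tight_support m0 lw); last by rewrite lt0r mj m0.
    by rewrite -eh mm sum_indic1 -[LHS]/(hull_at i).
  by split=> //; rewrite -(indic1_point i); apply/esym/same_moment_point => //; apply: indic1_mass.
have mm : same_moment (homog a) mu (indic R [set i]%SET).
  by apply: same_moment_comb => //; [exact: indic1_mass|rewrite indic1_point].
rewrite /hull_at (hullE (unit_affG a) m0 mm lw mZ) (complementary_slackness mZ) mm.
by rewrite sum_indic1.
Qed.

End LowerHull.

(** * From induced subdivisions to heights *)

Section Surjectivity.
Variables (R : realType) (n m k : nat) (v : 'I_k -> 'rV[R]_n) (A : 'M[R]_(n, m)).
Local Notation a := (proj_conf v A).
Local Notation evv := (ev (homog v)).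
Local Notation ev := (ev (homog a)).
Local Notation below := (below (homog a)).
Local Notation contact := (contact (homog a)).
Local Notation pat := (pat (homog a)).
Local Notation hull_v Z := (convf v (mem (Z : {set 'I_k}))).
Local Notation hull_a Z := (convf a (mem (Z : {set 'I_k}))).
Local Notation pi := (fun x : 'rV[R]_n => x *m A).

Definition labels (F : set 'rV[R]_n) : {set 'I_k} := [set i | `[< F (v i) >]]%SET.

Lemma face_labels F : (0 < k)%N -> face (convf v predT) F ->
  exists l : 'rV[R]_(n + 1), [/\ F = hull_v (labels F), labels F != finset.set0 &
    forall i, 0 <= evv l i /\ (evv l i == 0) = (i \in labels F)].
Proof.
move=> k0; rewrite convf_setT => /face_hull_ofP [|l [l0 [i0 _ i0l] FE]].
  by apply/finset.set0Pn; exists (Ordinal k0); rewrite finset.in_setT.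
have lE : labels F = [set i in [set: 'I_k]%SET | evv l i == 0]%SET.
  apply/setP => i; rewrite [LHS]finset.in_set [RHS]finset.in_set finset.in_setT /=.
  apply/asboolP/eqP => [|li].
    rewrite FE ev_homog; apply: hull_of_aff_eq0 => j.
    by rewrite inE => /andP[_ /eqP].
  by rewrite FE; apply: convf_point; rewrite /= inE finset.in_setT li eqxx.
exists l; rewrite lE; split=> //.
  by apply/finset.set0Pn; exists i0; rewrite inE finset.in_setT i0l eqxx.
move=> i; rewrite l0 ?finset.in_setT //; split=> //.
by rewrite [RHS]finset.in_set finset.in_setT.
Qed.

Variable lam : 'I_k -> R.
Hypothesis lamV : forall w : 'rV[R]_k, (w <= homog v)%MS <-> pairing lam w = 0.
Hypothesis lam_neq0 : exists i, lam i != 0.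

(* Flattening the lower hull of a coherent height function at the labels of the
   cells, and lifting all other heights off the hull, realizes the labelled
   subdivision [Fs] and not just its image. *)
Lemma induced_cells Fs : only_coherent a -> pi_induced pi (convf v predT) Fs ->
  exists2 w, balanced lam (pat w) & Fs = cells v A w.
Proof.
move=> coh [Fface Fsub Flab].
have [j0 lj0] := lam_neq0.
have k0 : (0 < k)%N by apply: leq_ltn_trans (ltn_ord j0).
have FE F : Fs F -> F = hull_v (labels F).
  by move=> /Fface /(face_labels k0) [l []].
have piE F : Fs F -> pi @` F = hull_a (labels F).
  by move=> /FE {1}->; rewrite proj_convf.
have QE : pi @` convf v predT = convf a predT by rewrite proj_convf.
rewrite QE in Fsub.
(* Coherence speaks only of the projected cells; the labels have to be recovered by modifying these
   heights. *)
have [w0 Sw0] : coherent_subdiv a [set pi @` F | F in Fs].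
  apply: coh; split=> // _ [F FF <-]; exists (labels F); exact: piE.
rewrite coherent_cells // in Sw0.
set w : 'rV[R]_k := \row_i w0 i in Sw0.
pose f := hull_at a w.
have [_ _ Sface Smeet Scov] := Fsub.
have cellF l : below l w -> contact l w != finset.set0 ->
    exists2 F, Fs F & pi @` F = hull_a (contact l w).
  move=> lw l0; have : [set pi @` F | F in Fs] (hull_a (contact l w)).
    by rewrite Sw0; exists (contact l w) => //; split=> //; exists l.
  by move=> [F]; exists F.
have Fcell F : Fs F -> exists l,
    [/\ below l w, contact l w != finset.set0 & pi @` F = hull_a (contact l w)].
  move=> FF; have : [set pi @` F | F in Fs] (pi @` F) by exists F.
  by rewrite Sw0 => -[Z [Z0 [l lw lZ]] <-]; exists l; rewrite lZ.
(* The intersection of the two images is a cell with its own label [F''], which the induced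
   condition cuts out of both [F] and [F']; labels therefore agree on overlaps. *)
have lab_meet F F' i : Fs F -> Fs F' -> F' (v i) -> (pi @` F) (a i) -> F (v i).
  move=> FF FF' iF' iF.
  have iI : (pi @` F `&` pi @` F') (a i) by split=> //; exists (v i).
  have [I0|[IF IF']] := Smeet (pi @` F) (pi @` F') (ex_intro2 _ _ F FF erefl)
    (ex_intro2 _ _ F' FF' erefl); first by rewrite I0 in iI.
  have [F'' FF'' e''] := Sface _ _ (ex_intro2 _ _ F FF erefl) IF.
  have s1 : pi @` F'' `<=` pi @` F by rewrite e'' => x [].
  have s2 : pi @` F'' `<=` pi @` F' by rewrite e'' => x [].
  have E1 := Flab _ _ FF'' FF s1; have E2 := Flab _ _ FF'' FF' s2.
  have iF'' : (pi @` F'') (a i) by rewrite e''.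
  have : F'' (v i) by rewrite E2; split.
  by rewrite E1 => -[].
pose U i := `[< exists2 F, Fs F & F (v i) >].
pose w' : 'rV[R]_k := \row_i (if U i then f i else f i + 1).
have fw' i : f i <= w' 0 i by rewrite mxE; case: ifP => // _; rewrite lerDl.
have claim1 F l : Fs F -> below l w -> pi @` F = hull_a (contact l w) ->
    below l w' /\ contact l w' = labels F.
  move=> FF lw FlE; split=> [i|]; first by apply: le_trans (fw' i); apply: hull_at_ge.
  apply/setP => i; rewrite inE mxE [RHS]finset.in_set.
  apply/eqP/asboolP => [|iF]; last first.
    have -> : U i by apply/asboolP; exists F.
    by apply/hull_at_contact => //; rewrite -FlE; exists (v i).
  case: ifPn => [/asboolP[F' FF' iF'] /hull_at_contact|_ e].
    by move=> /(_ lw); rewrite -FlE; apply: lab_meet iF'.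
  by have := hull_at_ge i lw; rewrite e -/f -[X in _ <= X]addr0 lerD2l ler10.
(* Lifted labels bound [l] more weakly, but [a i] is a convex combination of labels at hull height,
   where [l] is dominated by the function [l1] of a cell. *)
have claim2 l : below l w' -> below l w /\ forall i, ev l i <= f i.
  move=> lw'; have lf i : ev l i <= f i.
    have : convf a predT (a i) by apply: convf_point.
    rewrite -Scov => -[_ [F FF <-] iF].
    have [l1 [l1w _ F1E]] := Fcell F FF.
    have [l1w' c1] := claim1 F l1 FF l1w F1E.
    have <- : ev l1 i = f i by apply/hull_at_contact => //; rewrite -F1E.
    move: iF; rewrite piE // -c1 => /hull_ofP[mu [m0 mZ m1 iE]].
    rewrite !ev_homog iE !aff_comb //; apply: ler_sum => j _.
    have [|/mZ ->] := boolP (j \in contact l1 w'); last by rewrite !mul0r.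
    by rewrite inE => /eqP ->; rewrite ler_wpM2l.
  by split=> // i; apply: le_trans (lf i) (hull_at_le _ _ _).
(* A tight label satisfies [w' = ev l <= f <= w'], so [l] supports the original hull and its contact
   there spans a cell. *)
have claim3 l : below l w' -> contact l w' != finset.set0 ->
    exists2 F, Fs F & contact l w' = labels F.
  move=> lw' /finset.set0Pn[i]; rewrite inE => /eqP il.
  have [lw lf] := claim2 l lw'.
  have if_ : ev l i = f i by apply/eqP; rewrite eq_le lf il fw'.
  have /hull_at_contact-/(_ lw) il0 := if_.
  have [F FF FlE] := cellF l lw (hull_of_neq0 il0).
  by exists F => //; have [] := claim1 F l FF lw FlE.
exists w'.
  (* A contact is the label set of a face of [P]. The dependency annihilates a supporting function
     of that face, so this function cannot vanish on one Radon part alone. *)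
  have half (la : 'I_k -> R) : dependency (homog v) la -> (exists i, 0 < la i) ->
      pos_part la \in pat w' -> pos_part (fun i => - la i) \in pat w'.
    move=> dl [i1 li1] /patP[l [lw' sub]]; apply: (mem_pat_contact lw').
    have [|F FF lE] := claim3 l lw'.
      by apply/finset.set0Pn; exists i1; apply: (fintype.subsetP sub); rewrite inE.
    have [lv [_ _ H]] := face_labels k0 (Fface F FF).
    have neg i : 0 <= - (la i * evv lv i).
      rewrite oppr_ge0; have [li|li] := ltP 0 (la i); last first.
        by rewrite mulr_le0_ge0 //; have [] := H i.
      have : i \in labels F by rewrite -lE; apply: (fintype.subsetP sub); rewrite inE.
      by have [_ <-] := H i => /eqP ->; rewrite mulr0.
    have /eqP : \sum_i - (la i * evv lv i) = 0 by rewrite sumrN dl oppr0.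
    rewrite psumr_eq0 // => /allP z; apply/fintype.subsetP => i.
    rewrite inE oppr_gt0 lE => li; have [_ <-] := H i.
    have := z i (mem_index_enum _).
    by rewrite /= oppr_eq0 mulf_eq0 lt_eqF.
  have dv : dependency (homog v) lam.
    by move=> l; have /lamV : (l *m homog v <= homog v)%MS by apply: submxMl.
  have sl0 : \sum_i lam i = 0.
    rewrite -[RHS](dv (unit_aff R n)); apply: eq_bigr => i _.
    by rewrite (ev_e1 (unit_affG v)) mulr1.
  have posex (la : 'I_k -> R) : \sum_i la i = 0 -> (exists i, la i != 0) -> exists i, 0 < la i.
    move=> s0 n0; have := pos_mass_gt0 s0 n0; apply: contraPP => none.
    rewrite /pos_mass big1 ?ltxx // => i; rewrite inE => li.
    by case: none; exists i.
  apply/eqP; apply/idP/idP; first by apply: half => //; apply: posex.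
  rewrite -(pos_partNN lam); apply: half.
    exact: dependencyN.
  apply: posex; first by rewrite sumrN sl0 oppr0.
  by exists j0; rewrite oppr_eq0.
apply/seteqP; split=> [F FF|_ [Z [Z0 [l lw' lZ]] <-]].
  have [l [lw l0 FlE]] := Fcell F FF; have [lw' lE] := claim1 F l FF lw FlE.
  exists (labels F); last by rewrite -FE.
  split; last by exists l.
  by have [? []] := face_labels k0 (Fface F FF).
have [|F FF lE] := claim3 l lw'; first by rewrite lZ.
by rewrite -lZ lE -FE.
Qed.

End Surjectivity.

(** * Affine dimension and rank *)

Section AffineDimension.
Variables (R : realType) (d : nat).

Lemma homog_tr_row k (a : 'I_k -> 'rV[R]_d) (u : 'rV[R]_k) :
  u *m (homog a)^T = row_mx (\sum_i u 0 i *: a i) (const_mx (\sum_i u 0 i)).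
Proof.
rewrite /homog tr_col_mx mul_mx_row; congr row_mx; apply/rowP => j.
  rewrite mxE summxE; apply: eq_bigr => i _.
  by rewrite [X in _ * X]mxE [X in _ * X]mxE mxE.
rewrite mxE [RHS]mxE; apply: eq_bigr => i _.
by rewrite [X in _ * X]mxE [X in _ * X]mxE mulr1.
Qed.

Lemma homog_tr_row_eq0 k (a : 'I_k -> 'rV[R]_d) (u : 'rV[R]_k) :
  u *m (homog a)^T = 0 <-> \sum_i u 0 i *: a i = 0 /\ \sum_i u 0 i = 0.
Proof.
rewrite homog_tr_row; split=> [|[-> ->]].
  rewrite -[X in _ = X]row_mx0 => /eq_row_mx[-> /rowP /(_ 0)].
  by rewrite !mxE.
by rewrite (_ : const_mx 0 = 0) ?row_mx0.
Qed.

(** A linear relation among homogenized points has coefficient sum zero, so the coefficient of the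
    base point is minus the sum of the others and relations among differences correspond to it. *)
Lemma row_free_aff_indep q (p : 'I_q.+1 -> 'rV[R]_d) :
  row_free (homog p)^T <-> aff_indep_pts p.
Proof.
rewrite /aff_indep_pts; set D := \matrix_(i < q) _.
have uD (u : 'rV[R]_q) : u *m D = \sum_i u 0 i *: (p (lift ord0 i) - p ord0).
  by rewrite mulmx_sum_row; apply: eq_bigr => i _; rewrite rowK.
split=> [free|rD].
  apply/eqP; change (row_free D); apply: inj_row_free => u; rewrite uD => u0.
  pose u' : 'rV[R]_q.+1 := \row_i (if unlift ord0 i is Some j then u 0 j else - \sum_j u 0 j).
  have ul i : u' 0 (lift ord0 i) = u 0 i by rewrite mxE liftK.
  have u'0 : u' *m (homog p)^T = 0.
    apply/homog_tr_row_eq0; rewrite !big_ord_recl /= mxE unlift_none.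
    under eq_bigr do rewrite ul.
    under [\sum_(i < q) u' _ _]eq_bigr do rewrite ul.
    split; last by rewrite addNr.
    rewrite -[RHS]u0; under [RHS]eq_bigr do rewrite scalerBr.
    by rewrite sumrB -scaler_suml scaleNr addrC.
  have /(row_free_inj free) e : u' *m (homog p)^T = 0 *m (homog p)^T by rewrite u'0 mul0mx.
  by apply/rowP => i; rewrite -ul e !mxE.
apply: inj_row_free => u /homog_tr_row_eq0; rewrite !big_ord_recl => -[s0 s1].
have freeD : row_free D by rewrite /row_free rD.
have u0 : u 0 ord0 = - \sum_(i < q) u 0 (lift ord0 i).
  by apply/eqP; rewrite -addr_eq0; apply/eqP.
pose u' : 'rV[R]_q := \row_i u 0 (lift ord0 i).
have : u' *m D = 0 *m D.
  rewrite uD mul0mx -[RHS]s0 u0 scaleNr scaler_suml addrC -sumrB.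
  by apply: eq_bigr => i _; rewrite mxE scalerBr.
move=> /(row_free_inj freeD) e.
have ul i : u 0 (lift ord0 i) = 0.
  by have := congr1 (fun x : 'rV[R]_q => x 0 i) e; rewrite /= !mxE.
apply/rowP => i; rewrite mxE; case: (unliftP ord0 i) => [j ->|->]; first exact: ul.
by rewrite u0 big1 ?oppr0 // => j _; apply: ul.
Qed.

Lemma aff_pts_rank k (a : 'I_k -> 'rV[R]_d) q :
  has_aff_pts (convf a predT) q -> (q.+1 <= \rank (homog a))%N.
Proof.
move=> [p [pa /row_free_aff_indep]]; rewrite /row_free mxrank_tr => /eqP <-.
have /choice[mu Hmu] : forall i, exists mu : 'I_k -> R,
    \sum_j mu j = 1 /\ p i = \sum_j mu j *: a j.
  by move=> i; have [mu [_ [_ [m1 ->]]]] := pa i; exists mu.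
rewrite -mxrank_tr -[leqRHS]mxrank_tr.
have -> : (homog p)^T = (\matrix_(i, j) mu i j) *m (homog a)^T; last exact: mxrankM_maxr.
apply/row_matrixP => i; rewrite row_mul.
have -> : row i (homog p)^T = row_mx (p i) (const_mx 1).
  rewrite rowE homog_tr_row; congr (row_mx _ (const_mx _)).
    rewrite (bigD1 i) //= mxE !eqxx scale1r big1 ?addr0 // => j ji.
    by rewrite mxE (negPf ji) andbF scale0r.
  rewrite (bigD1 i) //= mxE !eqxx big1 ?addr0 // => j ji.
  by rewrite mxE (negPf ji) andbF.
have [m1 ->] := Hmu i; rewrite homog_tr_row.
congr (row_mx _ (const_mx _)).
  by apply: eq_bigr => j _; rewrite !mxE.
by rewrite -m1; apply: eq_bigr => j _; rewrite !mxE.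
Qed.

Lemma rank_aff_pts k (a : 'I_k -> 'rV[R]_d) q :
  (q.+1 <= \rank (homog a))%N -> has_aff_pts (convf a predT) q.
Proof.
rewrite -mxrank_tr => qr.
pose g i := maxrankfun (homog a)^T (widen_ord qr i).
exists (a \o g); split; first by move=> i; apply: convf_point.
apply/row_free_aff_indep.
have /row_freeP[B MB] := maxrowsub_free (homog a)^T.
apply/row_freeP; exists (colsub (widen_ord qr) B).
have -> : (homog (a \o g))^T = rowsub (widen_ord qr)
    (rowsub (maxrankfun (homog a)^T) (homog a)^T).
  apply/matrixP => i j; rewrite !mxE; case: (fintype.split j) => j'; by rewrite !mxE.
rewrite mulmx_colsub mul_rowsub_mx MB; apply/matrixP => i j; rewrite !mxE.
by congr (_%:R); congr (nat_of_bool _); apply/eqP/eqP => [[] /val_inj|->].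
Qed.

Lemma affdim_rank k (a : 'I_k -> 'rV[R]_d) q :
  is_affdim (convf a predT) q -> \rank (homog a) = q.+1.
Proof.
move=> [h nh]; apply/eqP; rewrite eqn_leq (aff_pts_rank h) andbT leqNgt.
by apply/negP => /rank_aff_pts.
Qed.

End AffineDimension.

(** The annihilator of the row space is a line, and a rank count shows that a nonzero vector of it
    cuts out the row space again. For the vertices of [P] this is their unique dependency. *)
Lemma hyperplane_functional (F : fieldType) p k (H : 'M[F]_(p, k)) :
  k = (\rank H).+1 ->
  exists lam : 'I_k -> F, (exists i, lam i != 0) /\
    forall w : 'rV_k, (w <= H)%MS <-> \sum_i lam i * w 0 i = 0.
Proof.
move=> kH; set K := kermx H^T.
have K0 : nz_row K != 0.
  by rewrite nz_row_eq0 -mxrank_eq0 mxrank_ker mxrank_tr subn_eq0 -ltnNge [X in (_ < X)%N]kH.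
set u := nz_row K in K0; exists (u 0); split.
  have [j] := rV0Pn _ K0; by exists j.
have uH : H *m u^T = 0.
  have /sub_kermxP := nz_row_sub K; rewrite -/u => /(congr1 trmx).
  by rewrite trmx_mul trmxK trmx0.
have HK : (H <= kermx u^T)%MS by apply/sub_kermxP.
have eqK : (H == kermx u^T)%MS.
  by rewrite -(mxrank_leqif_eq HK).2 mxrank_ker mxrank_tr rank_rV K0 [X in (X - _)%N]kH subn1 /=.
move=> w; rewrite (eqmxP eqK); split=> [/sub_kermxP /matrixP /(_ 0 0)|s0].
  by rewrite !mxE => e; rewrite -[RHS]e; apply: eq_bigr => i _; rewrite mxE mulrC.
apply/sub_kermxP/matrixP => i j; rewrite !ord1 mxE [RHS]mxE -[RHS]s0.
by apply: eq_bigr => c _; rewrite mxE mulrC.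
Qed.

(** * Assembly: the proper induced subdivisions as balanced patterns *)

Theorem theorem1p2 (R : realType) (n m : nat) (vs : seq 'rV[R]_n) (A : 'M[R]_(n, m))
    (dP dQ : nat) :
  let pi := fun x : 'rV[R]_n => x *m A in
  let P := conv vs in
  let Q := pi @` P in
  uniq vs ->
  [set` vs] = vertices P ->
  is_affdim P dP ->
  is_affdim Q dQ ->
  size vs = (dP + 2)%N ->
  only_coherent (fun i : 'I_(size vs) => pi vs`_i) ->
  htype_sphere R (proper_part (baues pi P) (@baues_le R n)) (@baues_le R n) (dP - dQ).
Proof.
move=> pi P Q _ _ dimP dimQ sz coh.
pose v (i : 'I_(size vs)) := vs`_i.
have PE : P = convf v predT by [].
have rkV : \rank (homog v) = dP.+1 by apply: affdim_rank.
have rkA : \rank (homog (proj_conf v A)) = dQ.+1.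
  by apply: affdim_rank; rewrite -proj_convf.
have [|lam [lam0 lamV]] := @hyperplane_functional _ _ _ (homog v).
  by rewrite rkV sz addn2.
have sub := homog_proj v A.
have dle : (dQ <= dP)%N by have := mxrankS sub; rewrite rkV rkA ltnS.
have rk : \rank (homog v) = (dP - dQ + \rank (homog (proj_conf v A)))%N.
  by rewrite rkV rkA addnS subnK.
(* [usphere] is indexed by the ambient dimension, so [dP - dQ] stands for the sphere of dimension
   one less, empty when the dimensions agree. *)
have sphere := radon_sphere (unit_affG (proj_conf v A)) sub lamV lam0 rk.
set X := radonX (homog (proj_conf v A)) lam in sphere.
pose rp Z := rep (unit_affG (proj_conf v A)) Z.
pose e (i : 'I_#|X|) := cells v A (rp (enum_val i)).
have inX (i : 'I_#|X|) : enum_val i \in X by exact: enum_valP.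
have rpE (i : 'I_#|X|) : pat (homog (proj_conf v A)) (rp (enum_val i)) = enum_val i.
  by apply/rep_pat/radonX_realizable/inX.
have bal (i : 'I_#|X|) : balanced lam (pat (homog (proj_conf v A)) (rp (enum_val i))).
  by rewrite rpE; have := inX i; rewrite inE => /andP[].
have leE (i j : 'I_#|X|) : baues_le (e i) (e j) <-> enum_val i \subset enum_val j.
  by rewrite (cells_le lamV) // !rpE.
exists #|X|, e; split; last split.
- move=> i j eij; apply: enum_val_inj; apply/eqP; rewrite finset.eqEsubset.
  by apply/andP; split; apply/leE; rewrite eij.
(* Zero heights have the full pattern; their subdivision lies above all others, so removing it
   matches the exclusion of the full pattern from [radonX]. *)
- have top : exists2 w0, cells v A w0 \in baues pi P &
      pat (homog (proj_conf v A)) w0 = [set: {set 'I_(size vs)}]%SET.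
    exists 0; last exact: (pat0 (homog (proj_conf v A))).
    rewrite inE; apply: (cells_induced lamV).
    by rewrite /balanced pat0 !finset.in_setT.
  apply/seteqP; split=> [_ [i _ <-]|Fs [FsB ntop]].
    split; first exact: cells_induced (bal i).
    move=> /(_ _ _) H; have [w0 w0B w0T] := top.
    have := H _ (set_mem w0B); rewrite (cells_le lamV) // w0T rpE finset.subTset => /eqP iT.
    by have /radonX_realizable := inX i; rewrite /realizable iT eqxx andbF.
  have [w bw FE] := induced_cells lamV lam0 coh FsB.
  have wT : pat (homog (proj_conf v A)) w != [set: {set 'I_(size vs)}]%SET.
    apply/eqP => wT; apply: ntop => Fs' Fs'B.
    have [w' bw' ->] := induced_cells lamV lam0 coh Fs'B.
    by rewrite FE (cells_le lamV) // wT finset.subsetT.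
  have wX : pat (homog (proj_conf v A)) w \in X by rewrite mem_radonX bw.
  exists (enum_rank_in wX (pat (homog (proj_conf v A)) w)) => //.
  by rewrite FE; apply: cells_pat; rewrite rpE enum_rankK_in.
rewrite (_ : realization (@baues_le R n) e = realization
   (fun Z Z' : {set {set 'I_(size vs)}} => Z \subset Z') (enum_val : 'I_#|X| -> _)) //.
by apply/seteqP; split=> t [t0 [t1 tch]]; split=> //; split=> // i j ti tj;
  have [/leE|/leE] := tch i j ti tj; by [left|right].
Qed.
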